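(* Let $X$ be a partite pure $n$-dimensional simplicial complex such that $X$ is gallery connected and the $1$-dimensional links of $X$ are connected finite graphs. Let $G$ be a locally compact, unimodular group acting on $X$ such that the action is cocompact and such that for every $\tau \in X(n-2) \cup X(n-1) \cup X(n)$ the subgroup $G_\tau$ stabilizing $\tau$ is an open compact subgroup of $G$. Assume that the matrix $\mathcal{A}(X)$ is positive definite. Then $G$ has property (T).
   Context: Simplicial complexes. An abstract simplicial complex $X$ with vertex set $V$ is a family of subsets of $V$ closed under taking subsets; $X(k)$ denotes the set of simplices in $X$ of cardinality $k+1$. $X$ is $n$-dimensional if $X(n+1)=\emptyset$ and $X(n) \neq \emptyset$, and pure $n$-dimensional if moreover every simplex of $X$ is contained in some $\sigma \in X(n)$. A pure $n$-dimensional $X$ is gallery connected if for all $\sigma,\sigma' \in X(n)$ there is a finite sequence $\sigma=\sigma_0,\dots,\sigma_l=\sigma'$ in $X(n)$ with $\sigma_i \cap \sigma_{i+1} \in X(n-1)$ for all $0 \leq i \leq l-1$. The link of $\tau \in X$ is $X_\tau = \{\eta \in X : \tau\cap\eta=\emptyset,\ \tau\cup\eta \in X\}$. The $1$-dimensional links are the graphs $X_\eta$ with $\eta \in X(n-2)$. A pure $n$-dimensional complex $X$ is partite if its vertex set has a partition $V = V_0 \sqcup \dots \sqcup V_n$ such that $|\sigma \cap V_i| = 1$ for every $\sigma \in X(n)$ and every $0 \leq i \leq n$. For $\tau \in X$, $\mathrm{type}(\tau) = \{ i : \tau \cap V_i \neq \emptyset \}$. The $1$-dimensional links of a partite complex are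 bipartite graphs. Actions. $G$ acts by simplicial automorphisms (not assumed to preserve types); cocompact means that there are finitely many orbits of simplices. Random walk. For a finite connected graph $(V,E)$ with $m(v)$ the degree of $v$, the random walk is the operator $A$ on $\ell^2(V,m)$ (functions $\phi : V \to \mathbb{C}$ with inner product $\langle \phi,\psi\rangle = \sum_{v} m(v)\phi(v)\overline{\psi(v)}$) given by $(A\phi)(v) = \sum_{u : \{u,v\}\in E} \frac{1}{m(v)}\phi(u)$. It is self-adjoint with eigenvalues in $[-1,1]$; $1$ is its largest eigenvalue, with multiplicity one. The matrix $\mathcal{A}(X)$. For $\eta \in X(n-2)$ let $\lambda_\eta$ be the second largest eigenvalue of the random walk on the connected finite bipartite graph $X_\eta$. For $0 \leq i,j \leq n$, $i \neq j$, let $\lambda_{i,j} = \max\{\lambda_\eta : \eta \in X(n-2),\ \mathrm{type}(\eta) = \{0,\dots,n\}\setminus\{i,j\}\}$ (by cocompactness of the action, $\lambda_\eta$ takes finitely many values). Then $\mathcal{A}(X)$ is the $(n+1)\times(n+1)$ real symmetric matrix with $\mathcal{A}(X)[i,i]=1$ and $\mathcal{A}(X)[i,j] = -\lambda_{i,j}$ for $i \neq j$ (indices $0 \leq i,j \leq n$). Property (T) is Kazhdan's property (T): there exist a compact set $K \subseteq G$ and $\varepsilon > 0$ such that for every continuous unitary representation $(\pi,\mathcal{H})$ of $G$ without non-zero invariant vectors and every unit vector $x\in\mathcal{H}$, $\sup_{g\in K}\|\pi(g)x-x\| \geq \varepsilon$. *)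

(* Defs.v *)
From HB Require Import structures.
From mathcomp Require Import all_boot all_order all_algebra.
From mathcomp Require Import finmap.
From mathcomp Require Import all_classical all_reals all_analysis.
From mathcomp Require Import complex.

Set Implicit Arguments.
Unset Strict Implicit.
Unset Printing Implicit Defensive.

Import Order.TTheory GRing.Theory Num.Theory.
Import numFieldNormedType.Exports.

Local Open Scope classical_set_scope.
Local Open Scope ring_scope.
Local Open Scope complex_scope.

(* {fset V} loses no generality: in a pure n-dimensional complex every simplex
   is finite. Elements v of V with [fset v] not in X are allowed. *)
Section SimplicialComplex.
Variable V : choiceType.
Implicit Types (X : set {fset V}) (s t : {fset V}).

Definition simplicial_complex X : Prop :=
  forall s t, X s -> (t `<=` s)%fset -> X t.

(* k is an integer because X(-1) and X(-2) occur below when the dimension is at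
   most 1; X(-1) contains the empty simplex and X(-2) is empty. *)
Definition simplices X (k : int) : set {fset V} :=
  [set s | X s /\ (#|` s|)%:Z = k + 1].

Definition has_dimension X (n : nat) : Prop :=
  simplices X (n%:Z + 1) = set0 /\ simplices X n%:Z !=set0.

Definition pure_dimensional X (n : nat) : Prop :=
  [/\ simplicial_complex X, has_dimension X n &
      forall s, X s -> exists2 t, simplices X n%:Z t & (s `<=` t)%fset].

Definition gallery_connected X (n : nat) : Prop :=
  forall s s', simplices X n%:Z s -> simplices X n%:Z s' ->
  exists (l : nat) (c : nat -> {fset V}),
    [/\ c 0%N = s, c l = s',
        forall i, (i <= l)%N -> simplices X n%:Z (c i) &
        forall i, (i < l)%N -> simplices X (n%:Z - 1) (c i `&` c i.+1)%fset].

Definition link X s : set {fset V} :=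
  [set t | [/\ X t, (s `&` t)%fset = fset0 & X (s `|` t)%fset]].

(* The partition V_0, ..., V_n of V is given by its class function part, so
   V_i is the preimage of i. *)
Definition partite X (n : nat) (part : V -> 'I_n.+1) : Prop :=
  forall s, simplices X n%:Z s ->
  forall i : 'I_n.+1, #|` [fset v in s | part v == i]%fset| = 1%N.

Definition type_of (n : nat) (part : V -> 'I_n.+1) s : {set 'I_n.+1} :=
  [set i | has (fun v => part v == i) s].

(* The graph underlying a complex Y with finitely many vertices. If Y has
   infinitely many vertices then vertices Y is a default value. *)
Definition vertices (Y : set {fset V}) : {fset V} :=
  fset_set [set v | Y [fset v]%fset].

Definition adjacent (Y : set {fset V}) : rel (vertices Y) :=
  fun u v => `[< simplices Y 1 [fset val u; val v]%fset >].

Definition connected_finite_graph (Y : set {fset V}) : Prop :=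
  finite_set Y /\ forall u v : vertices Y, connect (@adjacent Y) u v.

Definition connected_finite_1links X (n : nat) : Prop :=
  forall s, simplices X (n%:Z - 2) s -> connected_finite_graph (link X s).

End SimplicialComplex.

Section RandomWalk.
Variables (R : realType) (T : finType) (e : rel T).

Definition degree (v : T) : nat := #|[pred u | e v u]|.

Definition random_walk (phi : T -> R[i]) : T -> R[i] :=
  fun v => \sum_(u | e v u) (degree v)%:R^-1 * phi u.

(* The random walk is self-adjoint for the inner product weighted by degree, so
   its eigenvalues are all real. *)
Definition rw_eigenvalues : set R :=
  [set a | exists phi : T -> R[i],
     (exists v, phi v != 0) /\ forall v, random_walk phi v = a%:C * phi v].

(* On a connected graph the largest eigenvalue is simple, so the second largest
   one, counted with multiplicity, is the largest of the others. The set is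
   finite, hence both sup are maxima. *)
Definition second_eigenvalue : R :=
  sup (rw_eigenvalues `\ sup rw_eigenvalues).

End RandomWalk.

Section MatrixA.
Variables (R : realType) (V : choiceType) (X : set {fset V}).
Variables (n : nat) (part : V -> 'I_n.+1).

Definition link_eigenvalue (s : {fset V}) : R :=
  second_eigenvalue R (@adjacent V (link X s)).

(* When a group acts cocompactly this is the supremum of a finite set. *)
Definition type_eigenvalue (i j : 'I_n.+1) : R :=
  sup [set link_eigenvalue s | s in
        [set s | simplices X (n%:Z - 2) s /\ type_of part s = ~: [set i; j]]].

Definition A_matrix : 'M[R]_n.+1 :=
  \matrix_(i, j) if i == j then 1 else - type_eigenvalue i j.

End MatrixA.

Definition positive_definite (R : realType) (n : nat) (A : 'M[R]_n) : Prop :=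
  A^T = A /\ forall x : 'cV[R]_n, x != 0 -> 0 < (x^T *m A *m x) 0 0.

(* The base point, arbitrary and unrelated to the unit, is there only because
   generated sigma-algebras in the library are on pointed types. *)
HB.structure Definition PreTopologicalGroup :=
  {G of PointedTopological G & Group G}.

HB.mixin Record isTopologicalGroup G of PreTopologicalGroup G := {
  mulg_continuous : continuous (fun x : G * G => (x.1 * x.2)%g) ;
  invg_continuous : continuous (fun x : G => (x^-1)%g)
}.

#[short(type="topologicalGroupType")]
HB.structure Definition TopologicalGroup :=
  {G of PreTopologicalGroup G & isTopologicalGroup G}.

Definition locally_compact_group (G : topologicalGroupType) : Prop :=
  locally_compact [set: G] /\ hausdorff_space G.

Section Unimodular.
Variables (R : realType) (G : topologicalGroupType).

Notation borel := (g_sigma_algebraType (@open G)).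

Local Open Scope ereal_scope.

Definition radon_measure (mu : {measure set borel -> \bar R}) : Prop :=
  [/\ forall K : set G, compact K -> mu K < +oo,
      forall B : set G, measurable (B : set borel) ->
        mu B = ereal_inf [set mu U | U in [set U : set G | open U /\ B `<=` U]] &
      forall U : set G, open U ->
        mu U = ereal_sup [set mu K | K in [set K : set G | compact K /\ K `<=` U]]].

Definition left_invariant (mu : {measure set borel -> \bar R}) : Prop :=
  forall (g : G) (B : set G), measurable (B : set borel) ->
    mu [set (g * x)%g | x in B] = mu B.

Definition right_invariant (mu : {measure set borel -> \bar R}) : Prop :=
  forall (g : G) (B : set G), measurable (B : set borel) ->
    mu [set (x * g)%g | x in B] = mu B.

Definition haar_measure (mu : {measure set borel -> \bar R}) : Prop :=
  [/\ radon_measure mu, mu [set: G] != 0 & left_invariant mu].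

(* Haar measures are unique up to scaling, so one right-invariant left Haar
   measure is as good as all of them. *)
Definition unimodular : Prop :=
  exists mu : {measure set borel -> \bar R},
    haar_measure mu /\ right_invariant mu.

End Unimodular.

Section Action.
Variables (G : topologicalGroupType) (V : choiceType).
Variables (X : set {fset V}) (act : G -> V -> V).

Definition act_simplex (g : G) (s : {fset V}) : {fset V} := (act g @` s)%fset.

Definition simplicial_action : Prop :=
  [/\ forall v, act 1%g v = v,
      forall g h v, act (g * h)%g v = act g (act h v) &
      forall g s, X s -> X (act_simplex g s)].

Definition orbit_of (s : {fset V}) : set {fset V} :=
  [set act_simplex g s | g in [set: G]].

Definition cocompact : Prop := finite_set [set orbit_of s | s in X].

Definition stabilizer (s : {fset V}) : set G := [set g | act_simplex g s = s].

End Action.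

Section PropertyT.
Variables (R : realType) (G : topologicalGroupType).

(* A Hilbert space is a complete normed space over R[i] whose norm comes from
   the inner product ip, which is linear in its first argument. *)
Definition hilbert_norm (H : completeNormedModType R[i])
    (ip : {dot H for Num.conj}) : Prop :=
  forall x : H, `|x| ^+ 2 = ip x x.

Record unitary_representation (H : completeNormedModType R[i])
    (ip : {dot H for Num.conj}) (rep : G -> H -> H) : Prop := {
  rep_linear : forall g, linear (rep g) ;
  rep1 : forall x, rep 1%g x = x ;
  repM : forall g h x, rep (g * h)%g x = rep g (rep h x) ;
  rep_unitary : forall g x y, ip (rep g x) (rep g y) = ip x y ;
  rep_continuous : forall x, continuous (fun g => rep g x)
}.

Definition no_invariant_vectors (H : completeNormedModType R[i])
    (rep : G -> H -> H) : Prop :=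
  forall x, (forall g, rep g x = x) -> x = 0.

(* The norm of H takes its values in R[i]; Re brings them to R, where the
   supremum is taken. *)
Definition property_T : Prop :=
  exists (K : set G) (eps : R), [/\ compact K, 0 < eps &
    forall (H : completeNormedModType R[i]) (ip : {dot H for Num.conj})
      (rep : G -> H -> H),
    hilbert_norm ip -> unitary_representation ip rep ->
    no_invariant_vectors rep ->
    forall x : H, `|x| = 1 ->
      eps <= sup [set complex.Re `|rep g x - x| | g in K]].

End PropertyT.

(* Main.v *)
Require Import Defs.
From HB Require Import structures.
From mathcomp Require Import all_boot all_order all_algebra.
From mathcomp Require Import finmap.
From mathcomp Require Import all_classical all_reals all_analysis.
From mathcomp Require Import complex ring lra zify.

(** Let [phi] be a function from the chambers to the space of a unitary
    representation, equivariant under the type-preserving subgroup [G0].  For a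
    type [i], let [proj i phi] average [phi] over the chambers sharing their
    facet of cotype [i], and let [coproj i phi] be the difference.  If all the
    [coproj i phi] vanish, then [phi] is constant by gallery connectedness, and
    its value is a vector invariant under [G0].  So it suffices to show that an
    equivariant function with small [coproj i phi] lies near one for which they
    are zero.

    Equivariant functions are determined on finitely many orbit representatives.
    Weighting these by the inverse Haar measures of their stabilizers gives an
    inner product for which [proj i] is an orthogonal projection; this is a mass
    transport identity ([weight_locally_averaged]), and it rests on the two-sided
    invariance of the measure.  The same identity localizes the inner product of
    [coproj i phi] and [coproj j phi] to the chambers through a face of cotype
    [{i, j}], that is, to the edges of the bipartite graph in its link.  There,
    [bipartite_edge_angle] bounds it below by [- lambda_ij] times the product of
    the two norms, by diagonalizing the random walk.

    Let [T] be the sum of the [coproj i] and [E phi] the sum of the squared norms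
    of the [coproj i phi].  The squared norm of [T phi] is the sum of all these
    inner products, hence at least the quadratic form of the matrix at the vector
    of the norms, hence at least [c * E phi] for some [c > 0]
    ([laplacian_lower]).  Therefore the descent [phi - T phi / (n + 1)]
    multiplies [E] by at most a fixed factor below one and converges to a
    function at which [E] vanishes, at a distance controlled by the square root
    of [E phi] ([descent_limit]).

    Property (T) follows.  A vector [x] almost invariant under a suitable compact
    set is near vectors fixed by the stabilizers of the representatives
    ([almost_invariant_near_invariant]); these spread to an equivariant function
    of small energy, the descent gives a [G0]-invariant vector near [x], and as
    [G0] has finite index ([finite_index]), all of [G] moves [x] little.  The
    element of least norm among the vectors near the orbit of [x] is then a
    nonzero invariant vector ([property_T_of_uniform]). *)

Set Implicit Arguments.
Unset Strict Implicit.
Unset Printing Implicit Defensive.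

Import Order.TTheory GRing.Theory Num.Theory.
Import numFieldNormedType.Exports.

Local Open Scope classical_set_scope.
Local Open Scope ring_scope.
Local Open Scope complex_scope.

(** * Real inner products in a complex Hilbert space *)

Section RealToComplex.
Variable R : realType.

Lemma realcD (x y : R) : (x + y)%:C = x%:C + y%:C.
Proof. exact: (rmorphD (real_complex R)). Qed.

Lemma realcM (x y : R) : (x * y)%:C = x%:C * y%:C.
Proof. exact: (rmorphM (real_complex R)). Qed.

Lemma realcN (x : R) : (- x)%:C = - x%:C.
Proof. exact: (rmorphN (real_complex R)). Qed.

Lemma realc_nat n : (n%:R : R)%:C = n%:R.
Proof. exact: (rmorph_nat (real_complex R)). Qed.

Lemma conj_realc (x : R) : Num.conj x%:C = x%:C.
Proof. exact: conjc_real. Qed.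

End RealToComplex.

Lemma geometric_le_eps (R : realType) (a q e : R) : 0 <= q < 1 -> 0 < e ->
  exists N, a * q ^+ N <= e.
Proof.
move=> /andP[q0 q1] e0.
have /cvgrPdist_le : (fun n => q ^+ n) @ \oo --> (0 : R).
  by apply: cvg_expr; rewrite ger0_norm.
have a1 : 0 < `|a| + 1 by rewrite ltr_wpDl.
move/(_ _ (divr_gt0 e0 a1)) => [N _ /(_ N (leqnn N))] /=.
rewrite sub0r normrN ger0_norm ?exprn_ge0 // ler_pdivlMr // => hN; exists N.
apply: le_trans hN; rewrite mulrC ler_wpM2l ?exprn_ge0 //.
by rewrite (le_trans (ler_norm _)) // lerDl.
Qed.

Lemma geometric_bound_le0 (R : realType) (x a q : R) : 0 <= q < 1 ->
  (forall k, x <= a * q ^+ k) -> x <= 0.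
Proof.
move=> q01 xle; apply/ler_addgt0Pl => e e0; rewrite addr0.
by have [N HN] := geometric_le_eps a q01 e0; apply: le_trans HN.
Qed.

Section RealInnerProduct.
Variables (R : realType) (H : completeNormedModType R[i]).

Definition rnorm (x : H) : R := complex.Re `|x|.

Lemma rnormE x : `|x| = (rnorm x)%:C.
Proof. by rewrite /rnorm RRe_real // ger0_real. Qed.

Lemma rnorm_ge0 x : 0 <= rnorm x.
Proof. by rewrite -ler0c -rnormE normr_ge0. Qed.

Lemma rnorm0 : rnorm 0 = 0.
Proof. by apply: complexI; rewrite -rnormE normr0. Qed.

Lemma rnorm0_eq0 x : rnorm x = 0 -> x = 0.
Proof. by move=> h; apply/eqP; rewrite -normr_eq0 rnormE h. Qed.

Lemma rnormD x y : rnorm (x + y) <= rnorm x + rnorm y.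
Proof. by rewrite -lecR rmorphD /= -!rnormE ler_normD. Qed.

Lemma rnormN x : rnorm (- x) = rnorm x.
Proof. by apply: complexI; rewrite -!rnormE normrN. Qed.

Lemma rnormB x y : rnorm (x - y) = rnorm (y - x).
Proof. by rewrite -opprB rnormN. Qed.

Lemma rnormZ (a : R) x : 0 <= a -> rnorm (a%:C *: x) = a * rnorm x.
Proof.
move=> a0; apply: complexI; rewrite rmorphM /= -!rnormE normrZ.
by rewrite ger0_norm // ler0c.
Qed.

Lemma rnorm_dist3 x y z : rnorm (x - z) <= rnorm (x - y) + rnorm (y - z).
Proof. by rewrite (le_trans _ (rnormD _ _)) // addrA subrK. Qed.

Lemma rnorm_sum (I : Type) (r : seq I) (F : I -> H) :
  rnorm (\sum_(i <- r) F i) <= \sum_(i <- r) rnorm (F i).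
Proof.
elim/big_rec2: _ => [|i y x _ xy]; first by rewrite rnorm0.
by rewrite (le_trans (rnormD _ _)) // lerD2l.
Qed.

(** Completeness with real radii; all limits below are taken through it. *)
Lemma cauchy_has_limit (u : nat -> H) :
  (forall e : R, 0 < e -> exists N, forall m n, (N <= m)%N -> (N <= n)%N ->
     rnorm (u m - u n) <= e) ->
  exists l, forall e : R, 0 < e -> exists N, forall n, (N <= n)%N ->
     rnorm (l - u n) <= e.
Proof.
move=> uC.
have : cauchy (u @ \oo).
  apply/cauchy_exP => e e0.
  have eE : e = (complex.Re e)%:C by rewrite RRe_real // gtr0_real.
  have e'0 : 0 < complex.Re e / 2 by rewrite divr_gt0 // -ltcR -eE.
  have [N HN] := uC _ e'0; exists (u N); exists N => // n /= Nn.
  rewrite -ball_normE /ball_ /= rnormE eE ltcR.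
  by rewrite (le_lt_trans (HN _ _ _ Nn)) // ltr_pdivrMr // ltr_pMr ?ltr1n // -ltcR -eE.
move/cauchy_cvgP => /cvg_ex[l ul]; exists l => e e0.
have e0' : 0 < e%:C :> R[i] by rewrite ltcR.
move/cvgrPdist_lt : ul => /(_ _ e0') [N _ HN]; exists N => n Nn.
by have := HN n Nn; rewrite /= rnormE ltcR => /ltW.
Qed.

Lemma geometric_has_limit (u : nat -> H) (a q : R) : 0 <= a -> 0 <= q < 1 ->
  (forall k, rnorm (u k.+1 - u k) <= a * q ^+ k) ->
  exists l, forall k, rnorm (l - u k) <= a * q ^+ k / (1 - q).
Proof.
move=> a0 /andP[q0 q1] step.
have q10 : 0 < 1 - q by rewrite subr_gt0.
have tail k n : rnorm (u (k + n)%N - u k) <= a * q ^+ k / (1 - q).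
  suff : rnorm (u (k + n)%N - u k) <= a * q ^+ k * (1 - q ^+ n) / (1 - q).
    move/le_trans; apply; rewrite ler_pM2r ?invr_gt0 //.
    by rewrite ler_piMr ?mulr_ge0 ?exprn_ge0 // gerBl exprn_ge0.
  elim: n => [|n IH]; first by rewrite addn0 subrr rnorm0 subrr mulr0 mul0r.
  rewrite addnS (le_trans (rnorm_dist3 _ (u (k + n)%N) _)) //.
  rewrite (le_trans (lerD (step _) IH)) // le_eqVlt; apply/orP; left; apply/eqP.
  rewrite exprD exprS; field; rewrite gt_eqF //.
have geo0 (e : R) : 0 < e -> exists N, a * q ^+ N / (1 - q) <= e.
  move=> e0; have [|N HN] := @geometric_le_eps _ (a / (1 - q)) q e _ e0.
    by rewrite q0 q1.
  by exists N; rewrite mulrAC.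
have [|l hl] := @cauchy_has_limit u => [e e0|].
  have e20 : 0 < e / 2 by rewrite divr_gt0.
  have [N HN] := geo0 _ e20; exists N => m n Nm Nn.
  rewrite (le_trans (rnorm_dist3 _ (u N) _)) // (splitr e) lerD //.
    by rewrite -(subnKC Nm) (le_trans (tail _ _)).
  by rewrite rnormB -(subnKC Nn) (le_trans (tail _ _)).
exists l => k; apply/ler_addgt0Pl => e e0; have [N HN] := hl _ e0.
rewrite (le_trans (rnorm_dist3 _ (u (k + N)%N) _)) // lerD //.
by rewrite HN // leq_addl.
Qed.

Variable ip : {dot H for Num.conj}.

Definition rip (x y : H) : R := complex.Re (ip x y).

Lemma ipZl a x y : ip (a *: x) y = a * ip x y.
Proof. by rewrite linearZl_LR. Qed.

Lemma ipZr a x y : ip x (a *: y) = Num.conj a * ip x y.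
Proof. by rewrite linearZr_LR. Qed.

Lemma ripDl x y z : rip (x + y) z = rip x z + rip y z.
Proof. by rewrite /rip linearDl raddfD. Qed.

Lemma ripC x y : rip x y = rip y x.
Proof. by rewrite /rip hermC /= expr0 mul1r; case: (ip y x). Qed.

Lemma ripDr x y z : rip x (y + z) = rip x y + rip x z.
Proof. by rewrite ripC ripDl !(ripC x). Qed.

Lemma ripNl x y : rip (- x) y = - rip x y.
Proof. by rewrite /rip linearNl raddfN. Qed.

Lemma ripNr x y : rip x (- y) = - rip x y.
Proof. by rewrite ripC ripNl (ripC x). Qed.

Lemma ripBl x y z : rip (x - y) z = rip x z - rip y z.
Proof. by rewrite ripDl ripNl. Qed.

Lemma ripBr x y z : rip x (y - z) = rip x y - rip x z.
Proof. by rewrite ripDr ripNr. Qed.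

Lemma ripZl (a : R) x y : rip (a%:C *: x) y = a * rip x y.
Proof.
by rewrite /rip ipZl; case: (ip x y) => b c /=; rewrite mul0r subr0.
Qed.

Lemma ripZr (a : R) x y : rip x (a%:C *: y) = a * rip x y.
Proof. by rewrite ripC ripZl (ripC x). Qed.

Lemma rip0l x : rip 0 x = 0.
Proof. by rewrite /rip linear0l. Qed.

Lemma rip0r x : rip x 0 = 0.
Proof. by rewrite ripC rip0l. Qed.

Lemma rip_suml (I : Type) (r : seq I) (P : pred I) (F : I -> H) y :
  rip (\sum_(i <- r | P i) F i) y = \sum_(i <- r | P i) rip (F i) y.
Proof.
by apply: (big_morph (fun x => rip x y)) => [? ?|]; rewrite ?ripDl ?rip0l.
Qed.

Lemma rip_sumr (I : Type) (r : seq I) (P : pred I) (F : I -> H) y :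
  rip y (\sum_(i <- r | P i) F i) = \sum_(i <- r | P i) rip y (F i).
Proof. by rewrite ripC rip_suml; apply: eq_bigr => i _; rewrite ripC. Qed.

Lemma ip_rip x : ip x x = (rip x x)%:C.
Proof. by rewrite /rip RRe_real // ger0_real // dnorm_ge0. Qed.

Lemma rip_ge0 x : 0 <= rip x x.
Proof. by rewrite -ler0c -ip_rip dnorm_ge0. Qed.

Lemma rip_le_half x y : rip x y <= (rip x x + rip y y) / 2.
Proof.
have := rip_ge0 (x - y); rewrite ripBl !ripBr (ripC y x); lra.
Qed.

Lemma rip_le_scaled (t : R) x y : 0 < t ->
  `|rip x y| <= (t * rip x x + t^-1 * rip y y) / 2.
Proof.
move=> t0; have ti0 : 0 < t^-1 by rewrite invr_gt0.
suff le1 z : rip x z <= (t * rip x x + t^-1 * rip z z) / 2.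
  rewrite ler_norml le1 andbT lerNl -ripNr; apply: (le_trans (le1 _)).
  by rewrite ripNl ripNr opprK.
have := mulr_ge0 (ltW ti0) (rip_ge0 (t%:C *: x - z)).
rewrite ripBl !ripBr !ripZl !ripZr (ripC z x).
rewrite !mulrBr !mulrA mulVf ?gt_eqF // !mul1r; lra.
Qed.

Hypothesis ip_norm : hilbert_norm ip.

Lemma rnorm_sqr x : rnorm x ^+ 2 = rip x x.
Proof.
by apply: complexI; rewrite rmorphXn /= -rnormE ip_norm ip_rip.
Qed.

(** The parallelogram law makes every minimizing sequence of the norm over a
    convex set a Cauchy sequence. *)
Lemma closed_convex_min_norm (B : set H) x0 : B x0 ->
  (forall x y, B x -> B y -> B (2^-1%:C *: (x + y))) ->
  (forall x, (forall e, 0 < e -> exists2 y, B y & rnorm (x - y) <= e) -> B x) ->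
  exists2 y, B y & forall z, B z -> rnorm z <= rnorm y -> z = y.
Proof.
move=> Bx0 Bmid Bclosed.
pose S := [set rnorm x ^+ 2 | x in B].
have S0 : S !=set0 by exists (rnorm x0 ^+ 2), x0.
have Slb : lbound S 0 by move=> _ [x _ <-]; rewrite exprn_ge0 ?rnorm_ge0.
have infS : has_inf S by split=> //; exists 0.
set d := inf S.
have d_le z : B z -> d <= rnorm z ^+ 2 by move=> Bz; apply: ge_inf; [exists 0|exists z].
have close x y e : B x -> B y -> rnorm x ^+ 2 <= d + e -> rnorm y ^+ 2 <= d + e ->
    rnorm (x - y) ^+ 2 <= 4 * e.
  move=> Bx By xd yd; have := d_le _ (Bmid _ _ Bx By).
  move: xd yd; rewrite !rnorm_sqr ripZl ripZr !ripBl !ripBr !ripDl !ripDr (ripC y x).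
  lra.
have ex k : exists2 x, B x & rnorm x ^+ 2 <= d + k.+1%:R^-1.
  have k0 : 0 < k.+1%:R^-1 :> R by rewrite invr_gt0 ltr0n.
  have [_ [x Bx <-] hx] := inf_adherent k0 infS.
  by exists x => //; apply: ltW.
have [u uP] := choice (fun k => let: ex_intro2 x Bx hx := ex k in
  ex_intro (fun x => B x /\ rnorm x ^+ 2 <= d + k.+1%:R^-1) x (conj Bx hx)).
have inv_le k l : (k <= l)%N -> l.+1%:R^-1 <= k.+1%:R^-1 :> R.
  by move=> kl; rewrite lef_pV2 ?posrE ?ltr0n // ler_nat.
have small (e : R) : 0 < e -> exists N : nat, N.+1%:R^-1 < e.
  move=> e0; have [N HN] : exists N : nat, e^-1 < N%:R.
    exists (Num.bound e^-1); rewrite archi_boundP // invr_ge0 ltW //.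
  exists N; rewrite -[ltRHS]invrK ltf_pV2 ?posrE ?invr_gt0 ?ltr0n //.
  by rewrite (lt_trans HN) // ltr_nat.
have [|l hl] := @cauchy_has_limit u => [e e0|].
  have [|N HN] := small (e ^+ 2 / 4); first by rewrite divr_gt0 ?exprn_gt0.
  exists N => m n Nm Nn; rewrite -(@ler_pXn2r _ 2) ?nnegrE ?rnorm_ge0 ?(ltW e0) //.
  have [[Bm hm] [Bn hn]] := (uP m, uP n).
  have hx := close (u m) (u n) N.+1%:R^-1 Bm Bn.
  rewrite (le_trans (hx _ _)) ?(le_trans hm) ?(le_trans hn) ?lerD2l ?inv_le //.
  by move: HN; set v := _^-1; lra.
have Bl : B l.
  apply: Bclosed => e e0; have [N HN] := hl _ e0.
  by exists (u N); [case: (uP N)|exact: HN].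
have lmin z : B z -> rnorm l <= rnorm z.
  move=> Bz; apply/ler_addgt0Pl => e e0.
  have [N HN] := hl (e / 2) ltac:(by rewrite divr_gt0).
  have [|M HM] := small ((e / 2) ^+ 2); first by rewrite exprn_gt0 ?divr_gt0.
  pose m := maxn N M; have [Bm hm] := uP m.
  have : rnorm (u m) <= rnorm z + e / 2.
    rewrite -(@ler_pXn2r _ 2) ?nnegrE ?addr_ge0 ?rnorm_ge0 ?divr_ge0 ?(ltW e0) //.
    rewrite (le_trans hm) // sqrrD -addrA lerD ?d_le //.
    rewrite (le_trans (inv_le _ _ (leq_maxr N M))) // (le_trans (ltW HM)) //.
    by rewrite lerDr mulrn_wge0 ?mulr_ge0 ?rnorm_ge0 ?divr_ge0 ?(ltW e0).
  have := HN _ (leq_maxl N M); have := rnormD (l - u m) (u m).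
  rewrite subrK -/m; lra.
exists l => // z Bz zl.
have ld : rnorm l ^+ 2 <= d.
  apply: lb_le_inf => // _ [y By <-].
  by rewrite ler_pXn2r ?nnegrE ?rnorm_ge0 ?lmin.
have := close z l 0 Bz Bl; rewrite addr0 mulr0 => /(_ _ ld) h.
have zd : rnorm z ^+ 2 <= d.
  by apply: le_trans ld; rewrite ler_pXn2r ?nnegrE ?rnorm_ge0.
have {h}/h h := zd.
apply/eqP; rewrite -subr_eq0; apply/eqP/rnorm0_eq0/eqP.
by rewrite -sqrf_eq0 eq_le h exprn_ge0 ?rnorm_ge0.
Qed.

End RealInnerProduct.

(** * Almost invariant vectors *)

Section AlmostInvariant.
Variables (R : realType) (G : topologicalGroupType).
Variables (H : completeNormedModType R[i]) (ip : {dot H for Num.conj}).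
Variables (rep : G -> H -> H).
Hypotheses (ip_norm : hilbert_norm ip) (repU : unitary_representation ip rep).

Lemma rep_add g x y : rep g (x + y) = rep g x + rep g y.
Proof. by have := rep_linear repU g 1 x y; rewrite !scale1r. Qed.

Lemma rep0 g : rep g 0 = 0.
Proof. by apply: (addrI (rep g 0)); rewrite -rep_add !addr0. Qed.

Lemma rep_scale g a x : rep g (a *: x) = a *: rep g x.
Proof. by have := rep_linear repU g a x 0; rewrite rep0 !addr0. Qed.

Lemma rep_opp g x : rep g (- x) = - rep g x.
Proof. by rewrite -scaleN1r rep_scale scaleN1r. Qed.

Lemma rep_sub g x y : rep g (x - y) = rep g x - rep g y.
Proof. by rewrite rep_add rep_opp. Qed.

Lemma rep_sum g (I : Type) (r : seq I) (F : I -> H) :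
  rep g (\sum_(i <- r) F i) = \sum_(i <- r) rep g (F i).
Proof. by apply: (big_morph (rep g)) => [? ?|]; rewrite ?rep_add ?rep0. Qed.

Lemma rip_rep g x y : rip ip (rep g x) (rep g y) = rip ip x y.
Proof. by rewrite /rip (rep_unitary repU). Qed.

Lemma rnorm_rep g x : rnorm (rep g x) = rnorm x.
Proof.
by apply/eqP; rewrite -(@eqrXn2 _ 2) ?rnorm_ge0 // !(rnorm_sqr ip_norm) rip_rep.
Qed.

(** The vectors at distance at most [e] from the whole orbit of [x] form an
    invariant closed convex set, so its element of least norm is invariant. *)
Lemma almost_invariant_near_invariant (S : set G) x (e : R) :
  S 1%g -> (forall g h, S g -> S h -> S (g * h)%g) ->
  (forall g, S g -> S g^-1%g) ->
  (forall g, S g -> rnorm (rep g x - x) <= e) ->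
  exists y, (forall g, S g -> rep g y = y) /\ rnorm (y - x) <= e.
Proof.
move=> S1 SM SV xe.
pose B := [set z | forall g, S g -> rnorm (z - rep g x) <= e].
have Bx : B x by move=> g Sg; rewrite rnormB xe.
have [z z' Bz Bz' g Sg|z hz g Sg|y By ymin] := closed_convex_min_norm ip_norm Bx.
- have -> : 2^-1%:C *: (z + z') - rep g x =
      2^-1%:C *: ((z - rep g x) + (z' - rep g x)).
    rewrite addrACA [RHS]scalerDr; congr (_ + _). rewrite scalerDr -scalerDl.
    by rewrite -rmorphD /= (_ : 2^-1 + 2^-1 = 1 :> R) ?scale1r //; lra.
  rewrite rnormZ ?invr_ge0 // (le_trans (ler_wpM2l _ (rnormD _ _))) ?invr_ge0 //.
  by have := Bz _ Sg; have := Bz' _ Sg; lra.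
- apply/ler_addgt0Pr => d d0; have [y By hy] := hz d d0.
  by rewrite (le_trans (rnorm_dist3 _ y _)) // addrC lerD // By.
exists y; split=> [g Sg|]; last by have := By _ S1; rewrite (rep1 repU).
apply: ymin; last by rewrite rnorm_rep.
move=> h Sh; rewrite -(rnorm_rep g^-1%g) rep_sub -!(repM repU) mulVg (rep1 repU).
by apply: By; apply: SM => //; apply: SV.
Qed.

End AlmostInvariant.

Section Criterion.
Variables (R : realType) (G : topologicalGroupType).

(** If almost invariance on [K] forces almost invariance on all of [G], then the
    invariant vector found near a unit vector is not zero. *)
Lemma property_T_of_uniform (K : set G) (eps : R) :
  compact K -> K !=set0 -> 0 < eps ->
  (forall (H : completeNormedModType R[i]) (ip : {dot H for Num.conj})
      (rep : G -> H -> H), hilbert_norm ip -> unitary_representation ip rep ->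
    forall x : H, rnorm x = 1 ->
    (forall g, K g -> rnorm (rep g x - x) <= eps) ->
    forall g, rnorm (rep g x - x) <= 2^-1) ->
  property_T R G.
Proof.
move=> Kc [k0 Kk0] e0 main; exists K, eps; split=> // H ip rep ipn repU noinv x x1.
have x1' : rnorm x = 1 by rewrite /rnorm x1.
rewrite leNgt; apply/negP => lt.
have bnd g : K g -> rnorm (rep g x - x) <= eps.
  move=> Kg; apply/ltW/(le_lt_trans _ lt); apply: ub_le_sup; last by exists g.
  exists 2 => _ [h Kh <-]; rewrite -/(rnorm _) (le_trans (rnormD _ _)) //.
  by rewrite rnormN (rnorm_rep ipn repU) x1'; lra.
have [y [yinv yx]] := @almost_invariant_near_invariant _ _ _ _ _ ipn repU setT x 2^-1
  I (fun _ _ _ _ => I) (fun _ _ => I) (fun g _ => main _ _ _ ipn repU x x1' bnd g).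
have y0 : y = 0 by apply: noinv => g; apply: yinv.
by move: yx; rewrite y0 sub0r rnormN x1'; lra.
Qed.

Lemma compact_property_T : compact [set: G] -> property_T R G.
Proof.
move=> Gc; apply: (@property_T_of_uniform setT 2^-1) => //.
- by exists 1%g.
- by move=> H ip rep _ _ x _ h g; apply: h.
Qed.

End Criterion.

(** * Spectral decomposition of the random walk *)

Lemma unitarymxPr (C : numClosedFieldType) n (M : 'M[C]_n) :
  M \is unitarymx -> (M^T ^ Num.conj)%sesqui *m M = 1%:M.
Proof. by move=> Mu; rewrite -invmx_unitary // mulVmx // unitarymx_unit. Qed.

Section Spectral.
Variables (R : realType) (T : finType) (e : rel T).
Hypotheses (e_sym : symmetric e) (deg_gt0 : forall v, (0 < degree e v)%N).

Let d (v : T) : R := (degree e v)%:R.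
Let s (v : T) : R := Num.sqrt (d v).

Let d0 v : 0 < d v. Proof. by rewrite ltr0n. Qed.
Let s0 v : s v != 0. Proof. by rewrite gt_eqF ?sqrtr_gt0. Qed.
Let ss v : s v * s v = d v. Proof. by rewrite -expr2 sqr_sqrtr ?ltW. Qed.

Let N : 'M[R[i]]_#|T| :=
  \matrix_(a, b) ((e (enum_val a) (enum_val b))%:R / (s (enum_val a) * s (enum_val b)))%:C.

Let N_herm : N \is hermsymmx.
Proof.
apply/is_hermitianmxP; rewrite expr0 scale1r; apply/matrixP => a b.
by rewrite !mxE [RHS]conjc_real e_sym [s _ * s _]mulrC.
Qed.

(** Conjugating by the square roots of the degrees makes the random walk
    Hermitian, and its unitary diagonalization gives a basis of eigenfunctions
    that is orthonormal for the degree weights. *)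
Lemma random_walk_eigenbasis :
  exists (psi : 'I_#|T| -> T -> R[i]) (mu : 'I_#|T| -> R),
  [/\ forall k v, random_walk e (psi k) v = (mu k)%:C * psi k v,
      forall k l, \sum_v (d v)%:C * (psi k v * Num.conj (psi l v)) = (k == l)%:R &
      forall u v, \sum_k (d v)%:C * (psi k u * Num.conj (psi k v)) = (u == v)%:R].
Proof.
pose P := spectralmx N; pose D := spectral_diag N.
have Pu : P \is unitarymx := spectral_unitarymx N.
have PP : P *m (P^T ^ Num.conj)%sesqui = 1%:M by apply/unitarymxP.
have PP' := unitarymxPr Pu.
have Dreal k : (complex.Re (D 0 k))%:C = D 0 k.
  by rewrite RRe_real //; apply: (mxOverP (hermitian_spectral_diag_real N_herm)).
have PN : P *m N = diag_mx D *m P.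
  have /orthomx_spectralP {1}-> := hermitian_normalmx N_herm.
  by rewrite !mulmxA mulmxV ?mul1mx // spectral_unit.
pose psi k v := P k (enum_rank v) / (s v)%:C.
have conj_psi k v : Num.conj (psi k v) = Num.conj (P k (enum_rank v)) / (s v)%:C.
  by rewrite /psi rmorphM fmorphV /= [Num.conj (s v)%:C](conjc_real (s v)).
have sumE (F : 'I_#|T| -> R[i]) : \sum_j F j = \sum_v F (enum_rank v).
  by rewrite (reindex (@enum_rank T)) //; apply: onW_bij; apply: enum_rank_bij.
have sc v : (s v)%:C != 0 :> R[i] by rewrite fmorph_eq0.
have dE v : (d v)%:C = (s v)%:C * (s v)%:C by rewrite -rmorphM /= ss.
have dC v : (degree e v)%:R = (s v)%:C * (s v)%:C :> R[i] by rewrite -dE rmorph_nat.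
exists psi, (fun k => complex.Re (D 0 k)); split.
- move=> k v; rewrite Dreal /psi mulrA.
  have := congr1 (fun M : 'M[R[i]]_(#|T|) => M k (enum_rank v)) PN.
  rewrite mul_diag_mx !mxE => <-; rewrite mulr_suml sumE /random_walk big_mkcond.
  apply: eq_bigr => u _; rewrite mxE !enum_rankK e_sym.
  case: (e u v) => /=; last by rewrite mul0r rmorph0 mulr0 mul0r.
  rewrite dC mul1r.
  by rewrite fmorphV rmorphM /=; field; rewrite !sc.
- move=> k l; have := congr1 (fun M : 'M[R[i]]_(#|T|) => M k l) PP.
  rewrite !mxE sumE => <-; apply: eq_bigr => v _; rewrite !mxE conj_psi /psi dE.
  by field; rewrite sc.
- move=> u v; have := congr1 (fun M : 'M[R[i]]_(#|T|) => M (enum_rank v) (enum_rank u)) PP'.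
  rewrite !mxE (inj_eq enum_rank_inj) eq_sym => PPuv.
  transitivity ((s v)%:C / (s u)%:C * (u == v)%:R).
    rewrite -PPuv mulr_sumr; apply: eq_bigr => k _; rewrite !mxE conj_psi /psi dE.
    by field; rewrite !sc.
  by have [->|_] := eqVneq u v; rewrite ?mulr0 // mulr1 divff.
Qed.

End Spectral.

(** * Edge functions on a bipartite graph *)

Lemma exchange_edges (M : nmodType) (T : finType) (e : rel T) (P Q : pred T)
    (F : T -> T -> M) : symmetric e -> (forall u v, e u v -> P u = Q v) ->
  \sum_(u | P u) \sum_(v | e u v) F u v = \sum_(v | Q v) \sum_(u | e v u) F u v.
Proof.
move=> e_sym PQ; rewrite (exchange_big_dep Q) => [|u v Pu /PQ <-] //.
apply: eq_bigr => v Qv; apply: eq_bigl => u; rewrite andbC e_sym.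
by case: (boolP (e v u)) => //=; rewrite e_sym => /PQ ->.
Qed.

Section EigenvalueBounds.
Variables (R : realType) (T : finType) (e : rel T).
Hypotheses (e_sym : symmetric e) (deg_gt0 : forall v, (0 < degree e v)%N).
Variables (phi : T -> R[i]) (a : R).
Hypothesis phi_eigen : forall v, random_walk e phi v = a%:C * phi v.

(** Both signs matter: nonnegativity bounds the eigenvalues by one in absolute
    value, and the sum vanishes when [a = - s], which then determines the
    eigenfunction along each edge. *)
Lemma edge_sum_eigen (s : R) : s ^+ 2 = 1 ->
  \sum_u \sum_(v | e u v) `|phi u + s%:C * phi v| ^+ 2 =
  (2 * (1 + s * a))%:C * \sum_v (degree e v)%:R * `|phi v| ^+ 2.
Proof.
move=> s2.
have sJ : Num.conj s%:C = s%:C by exact: conj_realc.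
have aJ : Num.conj a%:C = a%:C by exact: conj_realc.
have sC2 : s%:C * s%:C = 1 by rewrite -expr2 -rmorphXn /= s2.
have nb v : \sum_(u | e v u) phi u = (degree e v)%:R * (a%:C * phi v).
  rewrite -phi_eigen /random_walk mulr_sumr; apply: eq_bigr => u _.
  by rewrite mulrA divff ?mul1r // pnatr_eq0 -lt0n.
have deg v (z : R[i]) : \sum_(u | e v u) z = (degree e v)%:R * z.
  by rewrite sumr_const mulr_natl.
have term u v : `|phi u + s%:C * phi v| ^+ 2 =
    phi u * Num.conj (phi u) + s%:C * (phi u * Num.conj (phi v)) +
    s%:C * (phi v * Num.conj (phi u)) + phi v * Num.conj (phi v).
  rewrite normCK rmorphD rmorphM /= sJ mulrDl !mulrDr.
  transitivity (phi u * Num.conj (phi u) + s%:C * (phi u * Num.conj (phi v)) +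
    s%:C * (phi v * Num.conj (phi u)) + s%:C * s%:C * (phi v * Num.conj (phi v))).
    ring.
  by rewrite sC2 mul1r.
under eq_bigr => u _ do under eq_bigr => v _ do rewrite term.
under eq_bigr => u _ do rewrite !big_split /=.
rewrite !big_split /=.
rewrite -!addrA [X in _ = X]mulr_sumr.
have -> : \sum_u \sum_(v | e u v) phi v * Num.conj (phi v) =
    \sum_u \sum_(v | e u v) phi u * Num.conj (phi u).
  by rewrite (@exchange_edges _ _ _ xpredT xpredT).
have -> : \sum_u \sum_(v | e u v) s%:C * (phi v * Num.conj (phi u)) =
    \sum_u (degree e u)%:R * (s%:C * a%:C * (phi u * Num.conj (phi u))).
  apply: eq_bigr => u _; rewrite -mulr_sumr -mulr_suml nb; ring.
have -> : \sum_u \sum_(v | e u v) s%:C * (phi u * Num.conj (phi v)) =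
    \sum_u (degree e u)%:R * (s%:C * a%:C * (phi u * Num.conj (phi u))).
  rewrite (@exchange_edges _ _ _ xpredT xpredT) //.
  apply: eq_bigr => u _; rewrite -mulr_sumr -mulr_suml nb; ring.
rewrite -!big_split /=; apply: eq_bigr => u _.
have -> : (2 * (1 + s * a))%:C = 2 * (1 + s%:C * a%:C) :> R[i].
  by rewrite realcM realc_nat realcD realcM.
rewrite deg normCK; ring.
Qed.

Let norm2_gt0 (v0 : T) : phi v0 != 0 ->
  0 < \sum_v (degree e v)%:R * `|phi v| ^+ 2.
Proof.
move=> nz; rewrite (bigD1 v0) //= ltr_wpDr //.
  by apply: sumr_ge0 => v _; rewrite mulr_ge0 ?exprn_ge0.
by rewrite mulr_gt0 ?ltr0n // exprn_gt0 // normr_gt0.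
Qed.

Lemma eigenvalue_le1 v0 : phi v0 != 0 -> `|a| <= 1.
Proof.
move=> nz; have key (s : R) : s ^+ 2 = 1 -> 0 <= 1 + s * a.
  move=> s2; have : 0 <= (2 * (1 + s * a))%:C * \sum_v (degree e v)%:R * `|phi v| ^+ 2.
    by rewrite -edge_sum_eigen //; do 2![apply: sumr_ge0 => ? _]; rewrite exprn_ge0.
  by rewrite pmulr_lge0 ?(norm2_gt0 nz) // ler0c pmulr_rge0.
have := key 1 (expr1n _ _); have := key (-1) (sqrr_sign R 1).
by rewrite mul1r mulN1r ler_norml; lra.
Qed.

Lemma eigenvalueN1_alternates u v : a = -1 -> e u v -> phi v = - phi u.
Proof.
move=> aN1 uv; have := edge_sum_eigen (expr1n _ 2).
rewrite aN1 mulrN1 subrr mulr0 mul0r => /eqP.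
rewrite psumr_eq0 => [/allP /(_ u)|? _]; last first.
  by apply: sumr_ge0 => ? _; rewrite exprn_ge0.
rewrite mem_index_enum => /(_ isT) /=.
rewrite psumr_eq0 => [/allP /(_ v)|? _]; last by rewrite exprn_ge0.
rewrite mem_index_enum uv => /(_ isT) /=.
by rewrite sqrf_eq0 normr_eq0 rmorph1 mul1r addrC addr_eq0 => /eqP.
Qed.

End EigenvalueBounds.

Section BipartiteEdges.
Variables (R : realType) (T : finType) (e : rel T) (S : pred T).
Hypotheses (e_sym : symmetric e) (deg_gt0 : forall v, (0 < degree e v)%N).
Hypothesis e_bip : forall u v, e u v -> S u = ~~ S v.
Variables (H : completeNormedModType R[i]) (ip : {dot H for Num.conj}).

Local Notation rip := (rip ip).
Let d (v : T) : R := (degree e v)%:R.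
Let d0 v : 0 < d v. Proof. by rewrite ltr0n. Qed.

Definition walk (g : T -> H) (v : T) : H :=
  ((d v)^-1)%:C *: \sum_(u | e v u) g u.

Lemma sum_nbr g v : \sum_(u | e v u) g u = (d v)%:C *: walk g v.
Proof. by rewrite /walk scalerA -realcM divff ?gt_eqF // scale1r. Qed.

Definition wip (g h : T -> H) : R := \sum_v d v * rip (g v) (h v).

Lemma edges_fst (F : T -> R) (P : pred T) :
  \sum_(u | P u) \sum_(v | e u v) F u = \sum_(u | P u) d u * F u.
Proof. by apply: eq_bigr => u _; rewrite sumr_const mulr_natl. Qed.

Lemma edges_swap (F : T -> T -> R) :
  \sum_(u | S u) \sum_(v | e u v) F u v =
  \sum_(v | ~~ S v) \sum_(u | e v u) F u v.
Proof. exact: exchange_edges. Qed.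

Lemma edges_rip_fst (g h : T -> H) (P : pred T) :
  \sum_(u | P u) \sum_(v | e u v) rip (g u) (h v) =
  \sum_(u | P u) d u * rip (g u) (walk h u).
Proof.
by apply: eq_bigr => u _; rewrite -rip_sumr sum_nbr ripZr.
Qed.

Section Coordinates.
Variables (psi : 'I_#|T| -> T -> R[i]) (mu : 'I_#|T| -> R).
Hypotheses
  (psi_eigen : forall k v, random_walk e (psi k) v = (mu k)%:C * psi k v)
  (psi_ortho : forall k l,
     \sum_v (d v)%:C * (psi k v * Num.conj (psi l v)) = (k == l)%:R)
  (psi_complete : forall u v,
     \sum_k (d v)%:C * (psi k u * Num.conj (psi k v)) = (u == v)%:R).

Definition coord (g : T -> H) k : H :=
  \sum_v ((d v)%:C * Num.conj (psi k v)) *: g v.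

Definition of_coord (c : 'I_#|T| -> H) v : H := \sum_k psi k v *: c k.

Lemma coordK c k : coord (of_coord c) k = c k.
Proof.
rewrite /coord /of_coord; under eq_bigr => v _.
  rewrite scaler_sumr; under eq_bigr => l _ do rewrite scalerA.
  over.
have E l : \sum_v (d v)%:C * Num.conj (psi k v) * psi l v = (l == k)%:R.
  by rewrite -psi_ortho; apply: eq_bigr => v _; rewrite -mulrA [Num.conj _ * _]mulrC.
rewrite exchange_big /= (bigD1 k) //= -scaler_suml E eqxx scale1r.
by rewrite big1 ?addr0 // => l lk; rewrite -scaler_suml E (negPf lk) scale0r.
Qed.

Lemma of_coordK g v : of_coord (coord g) v = g v.
Proof.
rewrite /coord /of_coord; under eq_bigr => k _.
  rewrite scaler_sumr; under eq_bigr => u _ do rewrite scalerA.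
  over.
have E u : \sum_k psi k v * ((d u)%:C * Num.conj (psi k u)) = (v == u)%:R.
  by rewrite -psi_complete; apply: eq_bigr => k _; rewrite mulrCA.
rewrite exchange_big /= (bigD1 v) //= -scaler_suml E eqxx scale1r.
rewrite big1 ?addr0 // => u uv; rewrite -scaler_suml E.
by rewrite eq_sym (negPf uv) scale0r.
Qed.

Lemma coordD g h k : coord (fun v => g v + h v) k = coord g k + coord h k.
Proof. by rewrite -big_split; apply: eq_bigr => v _; rewrite scalerDr. Qed.

Lemma coord_walk g k : coord (walk g) k = (mu k)%:C *: coord g k.
Proof.
rewrite /coord scaler_sumr.
under eq_bigr => v _.
  rewrite [_ * Num.conj _]mulrC -scalerA -sum_nbr scaler_sumr; over.
rewrite (@exchange_edges _ _ _ xpredT xpredT) //=; apply: eq_bigr => u _.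
rewrite -scaler_suml scalerA; congr (_ *: _).
rewrite -rmorph_sum /= mulrCA -(conj_realc (mu k)) -rmorphM -psi_eigen.
rewrite -{1}(conj_realc (d u)) -rmorphM; congr (Num.conj _).
rewrite /random_walk mulr_sumr; apply: eq_bigr => v _.
by rewrite mulrA /d realc_nat divff ?mul1r // pnatr_eq0 -lt0n.
Qed.

(** Parseval's identity. *)
Lemma sum_rip_coord g h : \sum_k rip (coord g k) (coord h k) = wip g h.
Proof.
rewrite /wip /rip; under [RHS]eq_bigr => v _.
  rewrite (_ : _ * _ = complex.Re (ip ((d v)%:C *: g v) (h v))); last first.
    by rewrite -[RHS]/(rip _ _) ripZl.
  rewrite -{1}(of_coordK h v) /of_coord linear_sumr /=; over.
rewrite -!raddf_sum; congr complex.Re.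
rewrite exchange_big /=; apply: eq_bigr => k _.
rewrite /coord linear_sumlz /=; apply: eq_bigr => v _.
by rewrite ipZr !ipZl mulrA [Num.conj _ * _]mulrC.
Qed.

End Coordinates.

(** An edge function is a symmetric [f], read only at adjacent pairs. *)
Definition avg (f : T -> T -> H) (v : T) : H :=
  ((d v)^-1)%:C *: \sum_(u | e v u) f v u.

Lemma sum_avg f v : \sum_(u | e v u) f v u = (d v)%:C *: avg f v.
Proof. by rewrite /avg scalerA -realcM divff ?gt_eqF // scale1r. Qed.

(** An eigenfunction for [-1] changes sign along every edge, so its pairing with
    the vertex averages of an edge function cancels edge by edge; on the other
    eigenspaces [1 + walk] is invertible.  The sum of the values of [x] at the
    two ends is then an edge function with the same averages as [f]. *)
Lemma avg_vertex_potential f : (forall u v, f u v = f v u) ->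
  exists x : T -> H, forall v, avg f v = x v + walk x v.
Proof.
move=> f_sym; have [psi [mu [psi_eigen psi_ortho psi_complete]]] :=
  random_walk_eigenbasis R e_sym deg_gt0.
have avg0 k : mu k = -1 -> coord psi (avg f) k = 0.
  move=> muN1; have alt u v : e u v -> psi k v = - psi k u.
    exact: (eigenvalueN1_alternates e_sym deg_gt0 (psi_eigen k) muN1).
  have E : coord psi (avg f) k = \sum_v \sum_(u | e v u) Num.conj (psi k v) *: f v u.
    apply: eq_bigr => v _.
    by rewrite -scaler_sumr sum_avg [RHS]scalerA [Num.conj _ * _]mulrC.
  have EN : coord psi (avg f) k = - coord psi (avg f) k.
    rewrite {2}E -sumrN E (@exchange_edges _ _ _ xpredT xpredT) //=.
    apply: eq_bigr => v _; rewrite -sumrN; apply: eq_bigr => u vu.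
    by rewrite (alt v u vu) rmorphN scaleNr f_sym.
  have : coord psi (avg f) k *+ 2 = 0 by rewrite mulr2n {2}EN subrr.
  by rewrite -scaler_nat => /eqP; rewrite scaler_eq0 pnatr_eq0 => /eqP.
pose c k : H := ((1 + mu k)^-1)%:C *: coord psi (avg f) k.
exists (of_coord psi c) => v; rewrite -(of_coordK psi_complete (avg f) v).
rewrite -[RHS](of_coordK psi_complete (fun v => of_coord psi c v + walk (of_coord psi c) v)).
apply: eq_bigr => k _; congr (_ *: _).
rewrite coordD (coord_walk psi_eigen) (coordK psi_ortho) -[X in X + _]scale1r -scalerDl.
have [muN1|muN1] := eqVneq (mu k) (-1); first by rewrite /c avg0 // !scaler0.
rewrite /c scalerA -realcD -realcM divff ?scale1r //.
by rewrite addrC addr_eq0.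
Qed.

(** Write [f] as the sum of the values of some [x] at the two ends, plus a part
    [r] with zero averages, which adds a nonpositive amount to the left-hand side
    and a nonnegative one to the right-hand side.  Let [c1] and [c2] be the
    coordinates, on an eigenfunction for [m], of the restrictions of [x] to the
    two sides.  Apart from [r], the two
    squared norms are sums of [(1 - m^2) |c1|^2] and [(1 - m^2) |c2|^2], and their product is
    the sum of [- m (1 - m^2) <c1, c2>], so that the eigenvalues [1] and [-1] do
    not contribute. *)
Lemma bipartite_edge_angle (kappa t : R) (f : T -> T -> H) :
  0 <= kappa -> 0 < t ->
  (forall a, rw_eigenvalues e a -> [\/ a = 1, a = -1 | `|a| <= kappa]) ->
  (forall u v, f u v = f v u) ->
  - (kappa / 2) * (t * (\sum_(u | S u) \sum_(v | e u v)
        rip (f u v - avg f v) (f u v - avg f v)) +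
      t^-1 * (\sum_(u | S u) \sum_(v | e u v)
        rip (f u v - avg f u) (f u v - avg f u))) <=
  \sum_(u | S u) \sum_(v | e u v) rip (f u v - avg f v) (f u v - avg f u).
Proof.
move=> kappa0 t0 eig f_sym; have [x xP] := avg_vertex_potential f_sym.
(* [r] is orthogonal to every function of one end of the edges. *)
pose y := walk x; pose r u v := f u v - x u - x v.
have r_sym u v : r u v = r v u by rewrite /r f_sym addrAC.
have r_sum u : \sum_(v | e u v) r u v = 0.
  have cst : \sum_(v | e u v) x u = (d u)%:C *: x u.
    by rewrite sumr_const -scaler_nat realc_nat.
  rewrite /r !big_split /= !sumrN sum_avg cst sum_nbr xP scalerDr.
  by apply/eqP; rewrite subr_eq0 subr_eq addrC.
have r_fst g : \sum_(u | S u) \sum_(v | e u v) rip (r u v) (g u) = 0.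
  by apply: big1 => u _; rewrite -rip_suml r_sum rip0l.
have r_snd g : \sum_(u | S u) \sum_(v | e u v) rip (r u v) (g v) = 0.
  rewrite edges_swap; apply: big1 => v _; under eq_bigr => u _ do rewrite r_sym.
  by rewrite -rip_suml r_sum rip0l.
have aE u v : f u v - avg f v = r u v + (x u - y v).
  by rewrite /r (addrAC (f u v)) addrA subrK xP -/(y v) opprD addrA.
have bE u v : f u v - avg f u = r u v + (x v - y u).
  by rewrite r_sym f_sym aE.
clearbody r.
pose E F := \sum_(u | S u) \sum_(v | e u v) (F u v : R).
have r1 g : E (fun u v => rip (r u v) (g u)) = 0 by exact: r_fst.
have r2 g : E (fun u v => rip (r u v) (g v)) = 0 by exact: r_snd.
have ED F1 F2 : E (fun u v => F1 u v + F2 u v) = E F1 + E F2.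
  by rewrite /E -big_split; apply: eq_bigr => u _; rewrite big_split.
have EN F1 : E (fun u v => - F1 u v) = - E F1.
  by rewrite /E -sumrN; apply: eq_bigr => u _; rewrite sumrN.
have eqE F1 F2 : (forall u v, F1 u v = F2 u v) -> E F1 = E F2.
  by move=> F12; apply: eq_bigr => u _; apply: eq_bigr => v _.
pose rho := E (fun u v => rip (r u v) (r u v)).
pose x1 u := if S u then x u else 0; pose x2 u := if S u then 0 else x u.
have y1 u : walk x1 u = if S u then 0 else y u.
  case: ifPn => Su; last first.
    rewrite /y /walk; congr (_ *: _); apply: eq_bigr => v uv.
    by rewrite /x1; move: (e_bip uv) Su; case: (S v) => // ->.
  rewrite /walk big1 ?scaler0 // => v uv.
  by rewrite /x1; move: (e_bip uv); rewrite Su; case: (S v).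
have y2 u : walk x2 u = if S u then y u else 0.
  case: ifPn => Su.
    rewrite /y /walk; congr (_ *: _); apply: eq_bigr => v uv.
    by rewrite /x2; move: (e_bip uv); rewrite Su; case: (S v).
  rewrite /walk big1 ?scaler0 // => v uv.
  by rewrite /x2; move: (e_bip uv) Su; case: (S v) => // ->.
have z1 u : walk (walk x1) u = if S u then walk y u else 0.
  case: ifPn => Su.
    rewrite /walk; congr (_ *: _); apply: eq_bigr => v uv.
    by rewrite -/(walk x1 v) y1; move: (e_bip uv); rewrite Su; case: (S v).
  rewrite [LHS]/walk big1 ?scaler0 // => v uv.
  by rewrite y1; move: (e_bip uv) Su; case: (S v) => // ->.
have Efst g h : E (fun u v => rip (g u) (h v)) = \sum_(u | S u) d u * rip (g u) (walk h u).
  exact: edges_rip_fst.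
have Esnd g h : E (fun u v => rip (g u) (h v)) = \sum_(v | ~~ S v) d v * rip (walk g v) (h v).
  rewrite /E edges_swap; under eq_bigr => v _ do under eq_bigr => u _ do rewrite ripC.
  by rewrite edges_rip_fst; apply: eq_bigr => v _; rewrite ripC.
have on_S F : (forall u, ~~ S u -> F u = 0) -> \sum_u F u = \sum_(u | S u) F u :> R.
  by move=> F0; rewrite [LHS](bigID S) /= [X in _ + X]big1 ?addr0.
have off_S F : (forall u, S u -> F u = 0) -> \sum_u F u = \sum_(u | ~~ S u) F u :> R.
  by move=> F0; rewrite [LHS](bigID S) /= [X in X + _]big1 ?add0r.
have E1 F : E (fun u _ => F u) = \sum_(u | S u) d u * F u by exact: edges_fst.
have E2 F : E (fun _ v => F v) = \sum_(v | ~~ S v) d v * F v.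
  by rewrite /E edges_swap edges_fst.
have w11 : wip x1 x1 = \sum_(u | S u) d u * rip (x u) (x u).
  rewrite /wip on_S => [|u]; first by apply: eq_bigr => u Su; rewrite /x1 Su.
  by rewrite /x1 => /negPf ->; rewrite rip0l mulr0.
have w22 : wip x2 x2 = \sum_(u | ~~ S u) d u * rip (x u) (x u).
  rewrite /wip off_S => [|u Su]; last by rewrite /x2 Su rip0l mulr0.
  by apply: eq_bigr => u /negPf Su; rewrite /x2 Su.
have wy1 : wip (walk x1) (walk x1) = \sum_(u | ~~ S u) d u * rip (y u) (y u).
  rewrite /wip off_S => [|u Su]; last by rewrite y1 Su rip0l mulr0.
  by apply: eq_bigr => u /negPf Su; rewrite y1 Su.
have wy2 : wip (walk x2) (walk x2) = \sum_(u | S u) d u * rip (y u) (y u).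
  rewrite /wip on_S => [|u /negPf Su]; last by rewrite y2 Su rip0l mulr0.
  by apply: eq_bigr => u Su; rewrite y2 Su.
have wxy : wip x1 (walk x2) = \sum_(u | S u) d u * rip (x u) (y u).
  rewrite /wip on_S => [|u /negPf Su]; last by rewrite y2 Su rip0r mulr0.
  by apply: eq_bigr => u Su; rewrite y2 /x1 Su.
have wyz : wip (walk x2) (walk (walk x1)) = \sum_(u | S u) d u * rip (y u) (walk y u).
  rewrite /wip on_S => [|u /negPf Su]; last by rewrite y2 Su rip0l mulr0.
  by apply: eq_bigr => u Su; rewrite y2 z1 Su.
have aaE : E (fun u v => rip (f u v - avg f v) (f u v - avg f v)) =
    rho + (wip x1 x1 - wip (walk x1) (walk x1)).
  rewrite (eqE _ (fun u v => rip (r u v) (r u v) + (rip (r u v) (x u) + rip (r u v) (x u)) +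
    - (rip (r u v) (y v) + rip (r u v) (y v)) +
    (rip (x u) (x u) + - (rip (x u) (y v) + rip (x u) (y v)) + rip (y v) (y v)))).
    rewrite !(ED, EN) (r1 x) (r2 y) E1 E2 Esnd w11 wy1 -/rho -/y; lra.
  move=> u v; rewrite aE !(ripDl, ripDr, ripNl, ripNr).
  by rewrite (ripC _ (x u) (r u v)) (ripC _ (y v) (r u v)) (ripC _ (y v) (x u)); lra.
have bbE : E (fun u v => rip (f u v - avg f u) (f u v - avg f u)) =
    rho + (wip x2 x2 - wip (walk x2) (walk x2)).
  rewrite (eqE _ (fun u v => rip (r u v) (r u v) + (rip (r u v) (x v) + rip (r u v) (x v)) +
    - (rip (r u v) (y u) + rip (r u v) (y u)) +
    (rip (x v) (x v) + - (rip (y u) (x v) + rip (y u) (x v)) + rip (y u) (y u)))).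
    rewrite !(ED, EN) (r1 y) (r2 x) E1 E2 Efst w22 wy2 -/rho -/y; lra.
  move=> u v; rewrite bE !(ripDl, ripDr, ripNl, ripNr).
  by rewrite (ripC _ (x v) (r u v)) (ripC _ (y u) (r u v)) (ripC _ (x v) (y u)); lra.
have abE : E (fun u v => rip (f u v - avg f v) (f u v - avg f u)) =
    rho + (wip (walk x2) (walk (walk x1)) - wip x1 (walk x2)).
  rewrite (eqE _ (fun u v => rip (r u v) (r u v) + rip (r u v) (x v) +
    - rip (r u v) (y u) + rip (r u v) (x u) + - rip (r u v) (y v) +
    (rip (x u) (x v) + - rip (x u) (y u) + - rip (y v) (x v) + rip (y u) (y v)))).
    rewrite !(ED, EN) (r1 x) (r1 y) (r2 x) (r2 y).
    rewrite (E1 (fun u => rip (x u) (y u))) (E2 (fun v => rip (y v) (x v))).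
    by rewrite (Efst y y) (Esnd x x) wxy wyz -/rho -/y; lra.
  move=> u v; rewrite aE bE !(ripDl, ripDr, ripNl, ripNr).
  by rewrite (ripC _ (x u) (r u v)) (ripC _ (y v) (r u v)) (ripC _ (y v) (y u)); lra.
rewrite -!/(E _) aaE bbE abE.
have rho0 : 0 <= rho.
  by do 2![apply: sumr_ge0 => ? _]; apply: rip_ge0.
have k0 : 0 <= kappa / 2 by rewrite divr_ge0.
have ti0 : 0 < t^-1 by rewrite invr_gt0.
suff main : - (kappa / 2) * (t * (wip x1 x1 - wip (walk x1) (walk x1)) +
      t^-1 * (wip x2 x2 - wip (walk x2) (walk x2))) <=
    wip (walk x2) (walk (walk x1)) - wip x1 (walk x2).
  have r3 : 0 <= kappa / 2 * (t * rho) by rewrite !mulr_ge0 // ltW.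
  have r4 : 0 <= kappa / 2 * (t^-1 * rho) by rewrite !mulr_ge0 // ltW.
  lra.
have [psi [mu [psi_eigen psi_ortho psi_complete]]] :=
  random_walk_eigenbasis R e_sym deg_gt0.
rewrite -!(sum_rip_coord psi_complete).
under [\sum_k rip (coord psi (walk x1) k) _]eq_bigr => k _ do
  rewrite (coord_walk psi_eigen) ripZl ripZr.
under [\sum_k rip (coord psi (walk x2) k) (coord psi (walk x2) k)]eq_bigr => k _ do
  rewrite (coord_walk psi_eigen) ripZl ripZr.
under [\sum_k rip _ (coord psi (walk (walk x1)) k)]eq_bigr => k _ do
  rewrite !(coord_walk psi_eigen) ripZl !ripZr.
under [\sum_k rip (coord psi x1 k) (coord psi (walk x2) k)]eq_bigr => k _ do
  rewrite (coord_walk psi_eigen) ripZr.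
rewrite -!sumrB !mulr_sumr -big_split mulr_sumr; apply: ler_sum => k _ /=.
have [v0 psi0] : exists v, psi k v != 0.
  apply: contrapT => /forallNP psi0; move: (psi_ortho k k); rewrite eqxx big1.
    by move/esym/eqP; rewrite oner_eq0.
  by move=> v _; have /negP := psi0 v; rewrite negbK => /eqP ->; rewrite mul0r mulr0.
have mu_eig : rw_eigenvalues e (mu k) by exists (psi k); split=> //; exists v0.
have mu1 := eigenvalue_le1 e_sym deg_gt0 (psi_eigen k) psi0.
rewrite (ripC _ (coord psi x2 k) (coord psi x1 k)).
have [->|->|muk] := eig _ mu_eig; [lra|lra|].
have r12 := rip_le_scaled ip (coord psi x1 k) (coord psi x2 k) t0.
move: r12 mu1 muk; set m := mu k; set q12 := rip _ (coord psi x2 k).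
set q11 := rip (coord psi x1 k) _; set q22 := rip (coord psi x2 k) _ => r12 mu1 muk.
have m2 : 0 <= 1 - m ^+ 2.
  by rewrite subr_ge0 -real_normK ?num_real // exprn_ile1 //.
have mq : m * q12 <= kappa * ((t * q11 + t^-1 * q22) / 2).
  by rewrite (le_trans (ler_norm _)) // normrM ler_pM //.
have := ler_wpM2l m2 mq; lra.
Qed.

End BipartiteEdges.

Section SecondEigenvalue.
Variables (R : realType) (T : finType) (e : rel T) (S : pred T) (v0 : T).
Hypotheses (e_sym : symmetric e) (deg_gt0 : forall v, (0 < degree e v)%N).
Hypothesis e_bip : forall u v, e u v -> S u = ~~ S v.

Local Notation eigs := (@rw_eigenvalues R T e).

Lemma rw_eigenvalues_le1 a : eigs a -> `|a| <= 1.
Proof. by move=> [phi [[v phiv] phiE]]; apply: eigenvalue_le1 phiE _ phiv. Qed.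

Lemma rw_eigenvalues1 : eigs 1.
Proof.
exists (fun _ => 1); split; first by exists v0; rewrite oner_eq0.
move=> v; rewrite /random_walk sumr_const !mulr1 -[LHS]mulr_natl.
by rewrite -/(degree e v) divff // pnatr_eq0 -lt0n deg_gt0.
Qed.

(** Changing the sign on one side negates the random walk. *)
Lemma rw_eigenvaluesN a : eigs a -> eigs (- a).
Proof.
move=> [phi [[v phiv] phiE]]; exists (fun u => (-1) ^+ S u * phi u); split.
  by exists v; rewrite mulf_neq0 // signr_eq0.
move=> u; rewrite realcN mulNr mulrCA -phiE /random_walk mulr_sumr -sumrN.
by apply: eq_bigr => w /e_bip ->; case: (S w); rewrite /= ?expr0 ?expr1; ring.
Qed.

Lemma sup_rw_eigenvalues : sup eigs = 1.
Proof.
apply/eqP; rewrite eq_le; apply/andP; split.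
  apply: ge_sup; first by exists 1; apply: rw_eigenvalues1.
  by move=> a /rw_eigenvalues_le1; apply/le_trans/ler_norm.
apply: ub_le_sup; last exact: rw_eigenvalues1.
by exists 1 => a /rw_eigenvalues_le1; apply/le_trans/ler_norm.
Qed.

Lemma le_second_eigenvalue a : eigs a -> a != 1 -> a <= second_eigenvalue R e.
Proof.
move=> ea a1; apply: ub_le_sup.
  by exists 1 => b [/rw_eigenvalues_le1 b1 _]; apply: le_trans b1; apply: ler_norm.
by split=> //; rewrite sup_rw_eigenvalues; apply/eqP.
Qed.

Let eigsN1 : (eigs `\ sup eigs) (- 1).
Proof.
split; first exact/rw_eigenvaluesN/rw_eigenvalues1.
by rewrite sup_rw_eigenvalues => /eqP; rewrite /= => /eqP; lra.
Qed.

Lemma second_eigenvalue_le1 : second_eigenvalue R e <= 1.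
Proof.
apply: ge_sup; first by exists (- 1).
by move=> a [/rw_eigenvalues_le1 a1 _]; apply: le_trans a1; apply: ler_norm.
Qed.

(** The spectrum is symmetric, so an eigenvalue strictly between [-1] and [1]
    and its opposite are both at most the second eigenvalue. *)
Lemma second_eigenvalue_ge0 : -1 < second_eigenvalue R e ->
  0 <= second_eigenvalue R e.
Proof.
move=> gtN1.
have [a [[ea a1]]] : exists a, (eigs `\ sup eigs) a /\ -1 < a.
  have [|a ha] := sup_gt _ gtN1; first by exists (-1).
  by exists a.
rewrite /= sup_rw_eigenvalues in a1; have {}a1 : a != 1 by apply/eqP.
move=> aN1; have aN : - a != 1 by rewrite eqr_oppLR gt_eqF.
have := le_second_eigenvalue ea a1.
have := le_second_eigenvalue (rw_eigenvaluesN ea) aN; lra.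
Qed.

Lemma rw_eigenvalues_cases kappa : second_eigenvalue R e <= kappa ->
  forall a, eigs a -> [\/ a = 1, a = -1 | `|a| <= kappa].
Proof.
move=> le_kappa a ea.
have [->|a1] := eqVneq a 1; first by constructor 1.
have [->|aN1] := eqVneq a (-1); first by constructor 2.
constructor 3; rewrite ler_norml lerNl; apply/andP.
split; apply: le_trans le_kappa; apply: le_second_eigenvalue => //.
  exact: rw_eigenvaluesN.
by rewrite eqr_oppLR.
Qed.

End SecondEigenvalue.

(** * Gradient descent towards the constant chamber functions *)

(** The optimal [t] is [B / A]; adding a small [e] to both keeps it defined when
    one of them vanishes. *)
Lemma geometric_mean_lower (R : realType) (kappa A B x : R) :
  0 <= kappa -> 0 <= A -> 0 <= B ->
  (forall t, 0 < t -> - (kappa / 2) * (t * A ^+ 2 + t^-1 * B ^+ 2) <= x) ->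
  - kappa * (A * B) <= x.
Proof.
move=> k0 A0 B0 xge; apply/ler_addgt0Pl => d d0.
pose e := Num.min 1 (d / (kappa * (A + B + 1) + 1)).
have D0 : 0 < kappa * (A + B + 1) + 1 by rewrite ltr_wpDl ?mulr_ge0 ?addr_ge0.
have e0 : 0 < e by rewrite lt_min ltr01 divr_gt0.
have e1 : e <= 1 by rewrite ge_min lexx.
have ed : e * (kappa * (A + B + 1) + 1) <= d by rewrite -ler_pdivlMr // ge_min lexx orbT.
have Ae : 0 < A + e by lra.
have Be : 0 < B + e by lra.
have := xge _ (divr_gt0 Be Ae); rewrite invf_div => {}xge.
have sq x0 : 0 <= x0 -> x0 ^+ 2 <= (x0 + e) ^+ 2.
  by move=> x00; rewrite ler_pXn2r ?nnegrE ?lerDl //; lra.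
have h1 : (B + e) / (A + e) * A ^+ 2 <= (A + e) * (B + e).
  by rewrite mulrAC ler_pdivrMr //; have := ler_wpM2l (ltW Be) (sq _ A0); lra.
have h2 : (A + e) / (B + e) * B ^+ 2 <= (A + e) * (B + e).
  by rewrite mulrAC ler_pdivrMr //; have := ler_wpM2l (ltW Ae) (sq _ B0); lra.
have k2 : 0 <= kappa / 2 by rewrite divr_ge0.
have h3 : (kappa / 2) * ((B + e) / (A + e) * A ^+ 2 + (A + e) / (B + e) * B ^+ 2) <=
   kappa * ((A + e) * (B + e)).
  by have := ler_wpM2l k2 (lerD h1 h2); lra.
have h4 : kappa * ((A + e) * (B + e)) <= kappa * (A * B) + d.
  have : kappa * e * (A + B + e) <= kappa * e * (A + B + 1).
    by rewrite ler_wpM2l ?mulr_ge0 ?(ltW e0) // lerD2l.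
  move: ed; lra.
lra.
Qed.

Section Descent.
Variables (R : realType) (G : topologicalGroupType).
Variables (H : completeNormedModType R[i]) (ip : {dot H for Num.conj}).
Variables (rep : G -> H -> H).
Hypotheses (ip_norm : hilbert_norm ip) (repU : unitary_representation ip rep).
Variables (C : choiceType) (G0 : set G) (act : G -> C -> C).
Hypothesis act_inj : forall g, G0 g -> injective (act g).
Variables (n : nat) (cls : 'I_n.+1 -> C -> {fset C}).
Hypotheses (cls_refl : forall i s, s \in cls i s)
  (cls_eq : forall i s t, t \in cls i s -> cls i t = cls i s)
  (cls_act : forall i g s, G0 g -> cls i (act g s) = (act g @` cls i s)%fset).
Variables (reps : seq C) (w : C -> R).
Hypotheses (w_gt0 : forall s, s \in reps -> 0 < w s)
  (reps_cover : forall t, exists g s, [/\ G0 g, s \in reps & t = act g s]).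

Local Notation rip := (rip ip).

Definition equivariant (phi : C -> H) :=
  forall g s, G0 g -> phi (act g s) = rep g (phi s).

(** The classes to keep in mind are those of the chambers that have the same
    facet of cotype [i]. *)
Definition proj i (phi : C -> H) (s : C) : H :=
  ((#|` cls i s|)%:R^-1)%:C *: \sum_(t <- cls i s) phi t.

Definition coproj i (phi : C -> H) (s : C) : H := phi s - proj i phi s.

Definition laplacian (phi : C -> H) (s : C) : H := \sum_i coproj i phi s.

Definition cip (phi psi : C -> H) : R := \sum_(s <- reps) w s * rip (phi s) (psi s).

Definition energy phi : R := \sum_i cip (coproj i phi) (coproj i phi).

(** What unimodularity provides: it makes the averaging operators self-adjoint
    for the weighted inner product of equivariant functions. *)
Definition locally_averaged (cl : C -> {fset C}) := forall F : C -> R,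
  (forall g s, G0 g -> F (act g s) = F s) ->
  \sum_(s <- reps) w s * F s =
  \sum_(s <- reps) w s * ((#|` cl s|)%:R^-1 * \sum_(t <- cl s) F t).

Hypothesis cls_averaged : forall i, locally_averaged (cls i).

Let card_cls i s : (#|` cls i s|)%:R != 0 :> R.
Proof. by rewrite pnatr_eq0 cardfs_eq0; apply/fset0Pn; exists s. Qed.

Lemma proj_cls i phi s t : t \in cls i s -> proj i phi t = proj i phi s.
Proof. by move=> ts; rewrite /proj (cls_eq ts). Qed.

Lemma sum_coproj i phi s : \sum_(t <- cls i s) coproj i phi t = 0.
Proof.
rewrite /coproj big_split /= sumrN.
rewrite [X in _ - X](eq_big_seq (fun=> proj i phi s)) => [|t ts]; last exact: proj_cls.
rewrite big_const_seq count_predT iter_addr_0 -scaler_nat -realc_nat /proj scalerA.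
by rewrite -realcM divff // scale1r subrr.
Qed.

Lemma equivariant_proj i phi : equivariant phi -> equivariant (proj i phi).
Proof.
move=> phiE g s G0g; rewrite /proj (rep_scale repU) (rep_sum repU) cls_act //.
rewrite card_imfset //=; last exact: act_inj.
rewrite big_imfset /= => [|? ? _ _]; last exact: act_inj.
by congr (_ *: _); apply: eq_bigr => t _; apply: phiE.
Qed.

Lemma equivariant_coproj i phi : equivariant phi -> equivariant (coproj i phi).
Proof.
by move=> phiE g s G0g; rewrite (rep_sub repU) -phiE // -equivariant_proj.
Qed.

Lemma equivariant_laplacian phi : equivariant phi -> equivariant (laplacian phi).
Proof.
move=> phiE g s G0g; rewrite /laplacian (rep_sum repU); apply: eq_bigr => i _.
exact: equivariant_coproj.
Qed.

Lemma projB i phi psi (a : R) s :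
  proj i (fun t => phi t - a%:C *: psi t) s = proj i phi s - a%:C *: proj i psi s.
Proof.
rewrite /proj big_split /= sumrN scalerDr scalerN -scaler_sumr !scalerA.
by rewrite [a%:C * _]mulrC.
Qed.

Lemma coprojB i phi psi (a : R) s :
  coproj i (fun t => phi t - a%:C *: psi t) s =
  coproj i phi s - a%:C *: coproj i psi s.
Proof.
rewrite /coproj projB scalerBr !opprB [X in _ + X = _]addrC addrACA.
by congr (_ + _); rewrite addrC.
Qed.

Lemma cipDl f g h : cip (fun s => f s + g s) h = cip f h + cip g h.
Proof. by rewrite -big_split; apply: eq_bigr => s _; rewrite ripDl mulrDr. Qed.

Lemma cipC f g : cip f g = cip g f.
Proof. by apply: eq_bigr => s _; rewrite ripC. Qed.

Lemma cipDr f g h : cip f (fun s => g s + h s) = cip f g + cip f h.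
Proof. by rewrite cipC cipDl !(cipC f). Qed.

Lemma cipZl (a : R) f g : cip (fun s => a%:C *: f s) g = a * cip f g.
Proof. by rewrite mulr_sumr; apply: eq_bigr => s _; rewrite ripZl mulrCA. Qed.

Lemma cip_suml (J : finType) (f : J -> C -> H) g :
  cip (fun s => \sum_j f j s) g = \sum_j cip (f j) g.
Proof.
by rewrite exchange_big; apply: eq_bigr => s _; rewrite rip_suml mulr_sumr.
Qed.

Lemma cip_ge0 f : 0 <= cip f f.
Proof.
rewrite /cip big_seq; apply: sumr_ge0 => s sr.
by rewrite mulr_ge0 ?rip_ge0 // ltW ?w_gt0.
Qed.

Lemma energy_ge0 phi : 0 <= energy phi.
Proof. by apply: sumr_ge0 => i _; apply: cip_ge0. Qed.

Lemma weight_rip_le_cip f s : s \in reps -> w s * rip (f s) (f s) <= cip f f.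
Proof.
move=> sr; rewrite /cip (big_rem s) //= lerDl big_seq; apply: sumr_ge0 => t tr.
by rewrite mulr_ge0 ?rip_ge0 // ltW ?w_gt0 // (mem_rem tr).
Qed.

(** The averaging operators are orthogonal projections of the equivariant
    functions; this is where the invariance of the weights enters. *)
Lemma coproj_proj_ortho i phi psi : equivariant phi -> equivariant psi ->
  cip (coproj i phi) (proj i psi) = 0.
Proof.
move=> phiE psiE; rewrite /cip (cls_averaged i) => [|g s G0g].
  apply: big1 => s _.
  rewrite [X in _ * (_ * X)](eq_big_seq (fun t => rip (coproj i phi t) (proj i psi s))).
    by rewrite -rip_suml sum_coproj rip0l !mulr0.
  by move=> t ts; rewrite (proj_cls _ ts).
by rewrite equivariant_coproj // equivariant_proj // (rip_rep repU).
Qed.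

Lemma cip_coproj i phi psi : equivariant phi -> equivariant psi ->
  cip (coproj i phi) (coproj i psi) = cip (coproj i phi) psi.
Proof.
move=> phiE psiE; rewrite [RHS](_ : _ = cip (coproj i phi)
  (fun s => coproj i psi s + proj i psi s)).
  by rewrite cipDr coproj_proj_ortho // addr0.
by apply: eq_bigr => s _; rewrite subrK.
Qed.

Lemma cip_coproj_le i psi : equivariant psi ->
  cip (coproj i psi) (coproj i psi) <= cip psi psi.
Proof.
move=> psiE; have := cip_ge0 (proj i psi).
have -> : cip psi psi = cip (fun s => coproj i psi s + proj i psi s)
    (fun s => coproj i psi s + proj i psi s).
  by apply: eq_bigr => s _; rewrite subrK.
rewrite cipDl (cipDr (coproj i psi)) (cipDr (proj i psi)).
rewrite (cipC (proj i psi) (coproj i psi)) coproj_proj_ortho //; lra.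
Qed.

Variables (cls2 : 'I_n.+1 -> 'I_n.+1 -> C -> {fset C}).
Variables (kappa : 'I_n.+1 -> 'I_n.+1 -> R) (c : R).
Hypotheses (cls2_averaged : forall i j, i != j -> locally_averaged (cls2 i j))
  (kappa_ge0 : forall i j, i != j -> 0 <= kappa i j)
  (cls2_angle : forall i j, i != j -> forall phi s (t : R), 0 < t ->
    - (kappa i j / 2) *
      (t * (\sum_(u <- cls2 i j s) rip (coproj i phi u) (coproj i phi u)) +
       t^-1 * (\sum_(u <- cls2 i j s) rip (coproj j phi u) (coproj j phi u))) <=
    \sum_(u <- cls2 i j s) rip (coproj i phi u) (coproj j phi u))
  (c01 : 0 < c <= 1)
  (kappa_gap : forall q : 'I_n.+1 -> R, c * (\sum_i q i ^+ 2) <=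
    \sum_i (q i ^+ 2 - \sum_(j | j != i) kappa i j * (q i * q j))).

Lemma cip_angle i j phi : i != j -> equivariant phi ->
  - kappa i j * (Num.sqrt (cip (coproj i phi) (coproj i phi)) *
                 Num.sqrt (cip (coproj j phi) (coproj j phi))) <=
  cip (coproj i phi) (coproj j phi).
Proof.
move=> ij phiE; apply: geometric_mean_lower; rewrite ?sqrtr_ge0 ?kappa_ge0 // => t t0.
rewrite !sqr_sqrtr ?cip_ge0 //.
pose m s := w s * (#|` cls2 i j s|)%:R^-1.
pose S k l s := \sum_(u <- cls2 i j s) rip (coproj k phi u) (coproj l phi u).
have avg k l : cip (coproj k phi) (coproj l phi) = \sum_(s <- reps) m s * S k l s.
  rewrite /cip (cls2_averaged ij) => [|g s G0g].
    by apply: eq_bigr => s _; rewrite mulrA.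
  by rewrite !equivariant_coproj // (rip_rep repU).
rewrite !avg !mulr_sumr -big_split /= mulr_sumr big_seq [leRHS]big_seq.
apply: ler_sum => s sr.
have m0 : 0 <= m s by rewrite mulr_ge0 ?invr_ge0 // ltW ?w_gt0.
have := ler_wpM2l m0 (cls2_angle ij phi s t0); rewrite -!/(S _ _ s); lra.
Qed.

Let N : R := n.+1%:R.
Let N_gt0 : 0 < N. Proof. by rewrite ltr0n. Qed.

(** By [cip_angle], the squared norm of the sum of the [coproj i phi] dominates
    the quadratic form of the gap hypothesis at their norms. *)
Lemma laplacian_lower phi : equivariant phi ->
  c * energy phi <= cip (laplacian phi) (laplacian phi).
Proof.
move=> phiE; pose q i := Num.sqrt (cip (coproj i phi) (coproj i phi)).
have q2 i : q i ^+ 2 = cip (coproj i phi) (coproj i phi) by rewrite sqr_sqrtr ?cip_ge0.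
rewrite /energy; under eq_bigr => i _ do rewrite -q2.
apply: (le_trans (kappa_gap q)); rewrite cip_suml; apply: ler_sum => i _.
rewrite cipC cip_suml [leRHS](bigD1 i) //= q2 lerD2l -sumrN; apply: ler_sum => j ji.
by rewrite -mulNr cipC cip_angle // eq_sym.
Qed.

Lemma laplacian_upper phi : cip (laplacian phi) (laplacian phi) <= N * energy phi.
Proof.
rewrite cip_suml; under eq_bigr => i _ do rewrite cipC cip_suml.
have le2 i j : cip (coproj j phi) (coproj i phi) <=
    (cip (coproj j phi) (coproj j phi) + cip (coproj i phi) (coproj i phi)) / 2.
  rewrite /cip -big_split /= mulr_suml big_seq [leRHS]big_seq; apply: ler_sum => s sr.
  by have := ler_wpM2l (ltW (w_gt0 sr)) (rip_le_half ip (coproj j phi s) (coproj i phi s)); lra.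
apply: (le_trans (ler_sum _ (fun i _ => ler_sum _ (fun j _ => le2 i j)))).
under eq_bigr => i _ do rewrite -mulr_suml big_split sumr_const card_ord -/(energy phi).
rewrite -mulr_suml big_split /= sumr_const card_ord !sumrMnl -/(energy phi).
by rewrite [N * _]mulr_natl; lra.
Qed.

(** The step is the inverse of the bound of [laplacian_upper], short enough for
    the energy to decrease. *)
Definition descent (phi : C -> H) (s : C) : H := phi s - (N^-1)%:C *: laplacian phi s.

Lemma equivariant_descent phi : equivariant phi -> equivariant (descent phi).
Proof.
move=> phiE g s G0g; rewrite (rep_sub repU) (rep_scale repU) -phiE //.
by rewrite -equivariant_laplacian.
Qed.

Lemma energy_descent phi : equivariant phi ->
  energy (descent phi) <= (1 - c / N) * energy phi.
Proof.
move=> phiE; have TE := equivariant_laplacian phiE; set T := laplacian phi.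
have E i : cip (coproj i (descent phi)) (coproj i (descent phi)) =
    cip (coproj i phi) (coproj i phi) - 2 * N^-1 * cip (coproj i phi) T +
    N^-1 ^+ 2 * cip (coproj i T) (coproj i T).
  rewrite -(@cip_coproj i phi T) //.
  transitivity (cip (fun s => coproj i phi s + (- N^-1)%:C *: coproj i T s)
                    (fun s => coproj i phi s + (- N^-1)%:C *: coproj i T s)).
    by apply: eq_bigr => s _; rewrite coprojB realcN scaleNr.
  rewrite cipDl (cipDr (coproj i phi)) cipZl (cipC _ (fun s => _ + _)).
  rewrite cipDl cipZl (cipC (coproj i phi) (fun s => _ *: _)) cipZl.
  by rewrite (cipC (coproj i T) (coproj i phi)); ring.
have up : energy (descent phi) <= energy phi - N^-1 * cip T T.
  rewrite /energy; under eq_bigr => i _ do rewrite E.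
  rewrite !big_split /= sumrN -!mulr_sumr -cip_suml -/(energy phi) -[cip _ T]/(cip T T).
  have : \sum_i cip (coproj i T) (coproj i T) <= N * cip T T.
    apply: (le_trans (ler_sum _ (fun i _ => cip_coproj_le i TE))).
    by rewrite sumr_const card_ord mulr_natl.
  have Ni : 0 <= N^-1 ^+ 2 by rewrite exprn_ge0 // invr_ge0 ltW.
  move/(ler_wpM2l Ni); rewrite [leRHS]mulrA expr2 -[_ * N]mulrA mulVf ?gt_eqF //.
  by rewrite mulr1; move: N^-1 => m h; lra.
have Ni : 0 <= N^-1 by rewrite invr_ge0 ltW.
by have := ler_wpM2l Ni (laplacian_lower phiE); move: N^-1 up => m up h; lra.
Qed.

Definition rate : R := Num.sqrt (1 - c / N).

Let rate_sqr : rate ^+ 2 = 1 - c / N.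
Proof.
rewrite sqr_sqrtr // subr_ge0 ler_pdivrMr // mul1r.
by case/andP: c01 => _ /le_trans; apply; rewrite ler1n.
Qed.

Lemma rate01 : 0 <= rate < 1.
Proof.
rewrite sqrtr_ge0 /= -(@ltr_pXn2r _ 2) ?nnegrE ?sqrtr_ge0 // rate_sqr expr1n.
by rewrite gtrBl divr_gt0 //; case/andP: c01.
Qed.

Lemma energy_iter phi k : equivariant phi ->
  equivariant (iter k descent phi) /\
  energy (iter k descent phi) <= energy phi * (rate ^+ k) ^+ 2.
Proof.
move=> phiE; elim: k => [|k [IHe IH]]; first by rewrite expr0 expr1n mulr1.
split; first exact: equivariant_descent.
rewrite iterS (le_trans (energy_descent IHe)) // -rate_sqr (exprS rate k) exprMn.
by rewrite [leRHS]mulrCA ler_wpM2l ?exprn_ge0 // sqrtr_ge0.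
Qed.

Let rnorm_le_of_weighted s (x : H) (e q : R) : s \in reps -> 0 <= q -> 0 <= e ->
  w s * rip x x <= e * q ^+ 2 ->
  rnorm x <= Num.sqrt e / Num.sqrt (w s) * q.
Proof.
move=> sr q0 e0 le; have ws := w_gt0 sr.
rewrite -(@ler_pXn2r _ 2) ?nnegrE ?rnorm_ge0 ?mulr_ge0 ?invr_ge0 ?sqrtr_ge0 //.
rewrite (rnorm_sqr ip_norm) 2!exprMn exprVn !sqr_sqrtr ?(ltW ws) //.
by rewrite mulrAC ler_pdivlMr // mulrC.
Qed.

(** The energy decreases geometrically along the descent, hence so do its steps;
    the limit has energy zero, so it equals its averages over the classes. *)
Lemma descent_limit phi : equivariant phi -> exists psi,
  [/\ equivariant psi,
      forall i s t, t \in cls i s -> psi t = psi s &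
      forall s, s \in reps -> rnorm (psi s - phi s) <=
        Num.sqrt (energy phi) / Num.sqrt (w s) / (1 - rate)].
Proof.
move=> phiE; pose f k := iter k descent phi.
have fE k : equivariant (f k) by case: (energy_iter k phiE).
have fen k : energy (f k) <= energy phi * (rate ^+ k) ^+ 2.
  by case: (energy_iter k phiE).
have [rate0 rate1] := andP rate01.
have r1 : 0 < 1 - rate by rewrite subr_gt0.
have rk k : 0 <= rate ^+ k by rewrite exprn_ge0.
pose b s := Num.sqrt (energy phi) / Num.sqrt (w s).
have step_rep s k : s \in reps -> rnorm (f k.+1 s - f k s) <= b s * rate ^+ k.
  move=> sr; apply: rnorm_le_of_weighted => //; first exact: energy_ge0.
  rewrite /f iterS -/(f k) /descent addrC addKr ripNl ripNr opprK ripZl ripZr.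
  have h := le_trans (weight_rip_le_cip (laplacian (f k)) sr) (laplacian_upper (f k)).
  have N1 : N^-1 <= 1 by rewrite invf_le1 // ler1n.
  have Ni : 0 <= N^-1 by rewrite invr_ge0 ltW.
  apply: le_trans (fen k); rewrite mulrCA (mulrCA (w s)).
  have le1 := ler_wpM2l Ni (ler_wpM2l Ni h).
  apply: le_trans le1 _; rewrite (mulrA N^-1 N) mulVf ?gt_eqF // mul1r.
  by rewrite ler_piMl ?energy_ge0.
have coproj_rep i s k : s \in reps -> rnorm (coproj i (f k) s) <= b s * rate ^+ k.
  move=> sr; apply: rnorm_le_of_weighted => //; first exact: energy_ge0.
  apply: le_trans (weight_rip_le_cip _ sr) (le_trans _ (fen k)).
  by rewrite /energy (bigD1 i) //= lerDl sumr_ge0 // => j _; apply: cip_ge0.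
have /choice[a aP] : forall t, exists a, [/\ 0 <= a,
    forall k, rnorm (f k.+1 t - f k t) <= a * rate ^+ k,
    forall i k, rnorm (coproj i (f k) t) <= a * rate ^+ k &
    t \in reps -> a = b t].
  move=> t; have b0 s : 0 <= b s by rewrite divr_ge0 ?sqrtr_ge0.
  have [tr|tr] := boolP (t \in reps); first by exists (b t); split=> // *; auto.
  have [g [s [G0g sr tE]]] := reps_cover t; rewrite tE in tr *.
  exists (b s); split=> // [k|i k].
  - by rewrite !fE // -(rep_sub repU) (rnorm_rep ip_norm repU) step_rep.
  - by rewrite equivariant_coproj // (rnorm_rep ip_norm repU) coproj_rep.
have a0 t : 0 <= a t by case: (aP t).
have /choice[psi psiP] : forall t, exists l, forall k,
    rnorm (l - f k t) <= a t * rate ^+ k / (1 - rate).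
  by move=> t; apply: geometric_has_limit; rewrite ?rate01 //; case: (aP t).
have psi_inf (x : H) e : (forall k, rnorm x <= e * rate ^+ k) -> x = 0.
  move=> le; apply: rnorm0_eq0; apply/eqP; rewrite eq_le rnorm_ge0 andbT.
  exact: geometric_bound_le0 rate01 le.
exists psi; split=> [g s G0g|i s t ts|s sr].
- apply/eqP; rewrite -subr_eq0; apply/eqP.
  apply: (psi_inf _ ((a (act g s) + a s) / (1 - rate))) => k.
  rewrite (le_trans (rnorm_dist3 _ (f k (act g s)) _)) //.
  rewrite mulrAC mulrDl mulrDl lerD //.
  by rewrite fE // -(rep_sub repU) (rnorm_rep ip_norm repU) rnormB psiP.
- have fixed u : psi u = proj i psi u.
    apply/eqP; rewrite -subr_eq0 -/(coproj i psi u); apply/eqP.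
    apply: (psi_inf _ (a u + (a u + \sum_(v <- cls i u) a v) / (1 - rate))) => k.
    have -> : coproj i psi u =
        coproj i (fun t => psi t - 1%:C *: f k t) u + coproj i (f k) u.
      by rewrite coprojB [1%:C *: _]scale1r subrK.
    rewrite (le_trans (rnormD _ _)) // addrC mulrDl lerD //; first by case: (aP u).
    have dif v : rnorm (psi v - 1%:C *: f k v) <= a v * rate ^+ k / (1 - rate).
      by rewrite scale1r psiP.
    rewrite (le_trans (rnormD _ _)) // rnormN mulrAC !mulrDl lerD ?dif //.
    rewrite rnormZ ?invr_ge0 // ler_pdivrMl ?lt0r ?card_cls ?ler0n //.
    rewrite (le_trans (rnorm_sum _ _)) // !mulr_suml (le_trans (ler_sum _ (fun v _ => dif v))) //.
    rewrite ler_peMl ?sumr_ge0 // => [v _|].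
      by rewrite divr_ge0 ?mulr_ge0 // ltW.
    by rewrite ler1n lt0n -(eqr_nat R) card_cls.
  by rewrite fixed (proj_cls _ ts) -fixed.
- have := psiP s 0%N; rewrite expr0 mulr1; case: (aP s) => _ _ _ -> //.
Qed.

Hypotheses (G01 : G0 1%g) (G0M : forall g h, G0 g -> G0 h -> G0 (g * h)%g)
  (G0V : forall g, G0 g -> G0 g^-1%g) (act1 : forall s, act 1%g s = s)
  (actM : forall g h s, act (g * h)%g s = act g (act h s)).
Variables (gg : C -> G) (rr : C -> C).
Hypotheses (ggP : forall t, [/\ G0 (gg t), rr t \in reps & t = act (gg t) (rr t)])
  (rr_act : forall g t, G0 g -> rr (act g t) = rr t).
Hypothesis chamber_connected : forall (P : C -> Prop) s, P s ->
  (forall s t i, P s -> t \in cls i s -> P t) -> forall t, P t.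

(** The first term is the distance of the initial function from [x], the second
    one the length of the descent, both in units of the almost invariance [e];
    the initial energy is at most [N (4 e)^2] times the total weight. *)
Definition displacement (s : C) : R :=
  2 + 4 * Num.sqrt (N * \sum_(u <- reps) w u) / Num.sqrt (w s) / (1 - rate).

(** A vector almost fixed by the stabilizers of the representatives and by the
    transporters to their neighbours spreads to an equivariant function of small
    energy; the limit of the descent is constant, and its value is invariant. *)
Lemma near_type_preserving_invariant x (e : R) s0 : 0 <= e -> s0 \in reps ->
  (forall s g, s \in reps -> G0 g -> act g s = s -> rnorm (rep g x - x) <= e) ->
  (forall s i t, s \in reps -> t \in cls i s -> rnorm (rep (gg t) x - x) <= e) ->
  exists y, (forall g, G0 g -> rep g y = y) /\ rnorm (y - x) <= e * displacement s0.
Proof.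
move=> e0 s0r stab_x nbr_x.
have /choice[y0 y0P] : forall s, exists y, s \in reps ->
    (forall g, G0 g -> act g s = s -> rep g y = y) /\ rnorm (y - x) <= e.
  move=> s; have [sr|_] := boolP (s \in reps); last by exists 0.
  have [||||y [yS yx]] := almost_invariant_near_invariant ip_norm repU
    (S := [set g | G0 g /\ act g s = s]) (x := x) (e := e).
  - by split.
  - by move=> g h [Gg gs] [Gh hs]; split; [exact: G0M|rewrite actM hs].
  - by move=> g [Gg gs]; split; [exact: G0V|rewrite -{1}gs -actM mulVg act1].
  - by move=> g [Gg gs]; apply: stab_x sr _ _.
  by exists y => _; split=> // g Gg gs; apply: yS.
pose phi t := rep (gg t) (y0 (rr t)).
have phiE : equivariant phi.
  move=> g t Gg; rewrite /phi rr_act //.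
  have [G1 rr1 e1] := ggP t; have [G2 _ e2] := ggP (act g t).
  have fixed : rep ((g * gg t)^-1 * gg (act g t))%g (y0 (rr t)) = y0 (rr t).
    apply: (y0P _ rr1).1; first by apply: G0M => //; apply: G0V; apply: G0M.
    rewrite rr_act // in e2.
    have e3 : act (gg (act g t)) (rr t) = act (g * gg t)%g (rr t).
      by rewrite -e2 actM -e1.
    by rewrite actM e3 -actM mulVg act1.
  by rewrite -[in RHS]fixed -!(repM repU) mulVKg.
have phi_near s i t : s \in reps -> t \in cls i s -> rnorm (phi t - x) <= 2 * e.
  move=> sr ts; have [_ rr1 _] := ggP t.
  rewrite (le_trans (rnorm_dist3 _ (rep (gg t) x) _)) // mulr2n mulrDl !mul1r lerD //.
    by rewrite -(rep_sub repU) (rnorm_rep ip_norm repU) (y0P _ rr1).2.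
  exact: nbr_x sr ts.
have coproj_small s i : s \in reps -> rnorm (coproj i phi s) <= 4 * e.
  move=> sr; have pE : proj i phi s - x =
      ((#|` cls i s|)%:R^-1)%:C *: \sum_(t <- cls i s) (phi t - x).
    rewrite /proj big_split /= big_const_seq count_predT iter_addr_0 scalerDr.
    by rewrite -(scaler_nat _ (- x)) -realc_nat scalerA -realcM mulVf // scale1r.
  rewrite /coproj (le_trans (rnorm_dist3 _ x _)) // (_ : 4 * e = 2 * e + 2 * e); last lra.
  rewrite lerD ?(phi_near s i) // rnormB pE rnormZ ?invr_ge0 //.
  rewrite ler_pdivrMl ?lt0r ?card_cls ?ler0n // (le_trans (rnorm_sum _ _)) //.
  rewrite big_seq (le_trans (ler_sum _ (fun t ts => phi_near s i t sr ts))) //.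
  by rewrite -big_seq big_const_seq count_predT iter_addr_0 -(mulr_natl (2 * e)).
have energy_small : energy phi <= N * (\sum_(u <- reps) w u) * (4 * e) ^+ 2.
  have le1 i : cip (coproj i phi) (coproj i phi) <= (\sum_(u <- reps) w u) * (4 * e) ^+ 2.
    rewrite mulr_suml /cip big_seq [leRHS]big_seq; apply: ler_sum => s sr.
    rewrite ler_wpM2l ?(ltW (w_gt0 sr)) // -(rnorm_sqr ip_norm).
    by rewrite ler_pXn2r ?nnegrE ?rnorm_ge0 ?coproj_small ?mulr_ge0.
  apply: (le_trans (ler_sum _ (fun i _ => le1 i))).
  by rewrite sumr_const card_ord -mulrA [N * _]mulr_natl.
have [psi [psiE psi_cls psi_near]] := descent_limit phiE.
have psi_const : forall t, psi t = psi s0.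
  by apply: (chamber_connected (s := s0)) => // s t i <- ts; apply: psi_cls ts.
exists (psi s0); split=> [g Gg|]; first by rewrite -psiE // psi_const.
rewrite (le_trans (rnorm_dist3 _ (phi s0) _)) // addrC /displacement mulrDr lerD //.
  by rewrite mulrC (phi_near s0 ord0).
apply: le_trans (psi_near _ s0r) _; rewrite !mulrA.
have [_ r1] := andP rate01.
rewrite ler_wpM2r ?invr_ge0 ?subr_ge0 ?(ltW r1) // ler_wpM2r ?invr_ge0 ?sqrtr_ge0 //.
have W0 : 0 <= N * \sum_(u <- reps) w u.
  rewrite mulr_ge0 ?(ltW N_gt0) // big_seq; apply: sumr_ge0 => s sr.
  by rewrite ltW ?w_gt0.
rewrite (le_trans (ler_wsqrtr energy_small)) // sqrtrM // sqrtr_sqr.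
by rewrite ger0_norm ?mulr_ge0 // mulrC [e * 4]mulrC.
Qed.

End Descent.

(** * Orbit weights from a Haar measure *)

Section HaarMeasure.
Variables (R : realType) (G : topologicalGroupType).

Local Notation borel := (g_sigma_algebraType (@open G)).

Variable mu : {measure set borel -> \bar R}.
Hypotheses (G_hausdorff : hausdorff_space G) (mu_haar : haar_measure mu)
  (mu_right : right_invariant mu).

Lemma mulg_left_continuous (g : G) : continuous (fun x : G => (g * x)%g).
Proof.
move=> x; apply: (@continuous_comp _ _ _ (fun y : G => (g, y)) (fun p => (p.1 * p.2)%g)).
  by apply: cvg_pair => //; apply: cvg_cst.
exact: mulg_continuous.
Qed.

Lemma open_translate (g : G) (U : set G) : open U -> open [set (g * x)%g | x in U].
Proof.
move=> Uo; suff -> : [set (g * x)%g | x in U] = (fun x : G => (g^-1 * x)%g) @^-1` U.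
  by apply: open_comp => // x _; apply: mulg_left_continuous.
apply/seteqP; split=> [_ [x Ux <-]|x Ux] /=; first by rewrite mulKg.
by exists (g^-1 * x)%g => //; rewrite mulVKg.
Qed.

Lemma open_borel (U : set G) : open U -> measurable (U : set borel).
Proof. by move=> Uo; apply: sub_gen_smallest. Qed.

Local Open Scope ereal_scope.

Lemma haar_compact_lt_pinfty (K : set G) : compact K -> mu K < +oo.
Proof. by case: mu_haar => -[muK _ _] _ _; apply: muK. Qed.

(** Translates of a null open set would cover every compact set. *)
Lemma haar_open_gt0 (U : set G) : open U -> U !=set0 -> 0 < mu U.
Proof.
move=> Uo [u0 Uu0]; rewrite lt0e measure_ge0 andbT; apply/negP => /eqP mu0.
case: mu_haar => -[_ _ inner] /negP muT left_inv; apply: muT.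
rewrite inner; last exact: openT.
rewrite eq_le; apply/andP; split; last first.
  by apply: ereal_sup_ubound; exists set0; [split=> //; exact: compact0|exact: measure0].
apply: ge_ereal_sup => _ [K [Kc _] <-].
have Km : measurable (K : set borel).
  rewrite -[K]setCK; apply: measurableC; apply: open_borel.
  by rewrite openC; apply: compact_closed.
have := Kc; rewrite compact_cover => /(_ G setT (fun g => [set (g * x)%g | x in U])) [].
- by move=> g _; apply: open_translate.
- by move=> x _; exists (x * u0^-1)%g => //; exists u0 => //; rewrite mulgVK.
move=> D _ KD.
have := content_sub_fsum mu (finite_fset D) (fun g _ => open_borel (open_translate g Uo)) Km KD.
move/le_trans; apply; rewrite fsbig1 // => g _.
by apply: etrans mu0; apply: left_inv; apply: open_borel.
Qed.

Section Orbits.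
Variables (C : choiceType) (G0 : set G) (act : G -> C -> C).
Hypotheses (G01 : G0 1%g) (G0M : forall g h, G0 g -> G0 h -> G0 (g * h)%g)
  (G0V : forall g, G0 g -> G0 g^-1%g)
  (act1 : forall s, act 1%g s = s)
  (actM : forall g h s, act (g * h)%g s = act g (act h s)).

Definition transporter (s t : C) : set G := [set g | G0 g /\ act g s = t].

Hypotheses (stab_open : forall s, open (transporter s s))
  (stab_compact : forall s, compact (transporter s s)).

Definition weight (s : C) : R := (fine (mu (transporter s s)))^-1.

Let actK g s : act g^-1%g (act g s) = s.
Proof. by rewrite -actM mulVg act1. Qed.

Let actVK g s : act g (act g^-1%g s) = s.
Proof. by rewrite -actM mulgV act1. Qed.

Lemma transporter_left s t g : transporter s t g ->
  transporter s t = [set (g * x)%g | x in transporter s s].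
Proof.
move=> [G0g gs]; apply/seteqP; split=> [h [G0h hs]|_ [h [G0h hs] <-]].
  exists (g^-1 * h)%g; last by rewrite mulVKg.
  by split; [apply: G0M => //; apply: G0V|rewrite actM hs -gs actK].
by split; [apply: G0M|rewrite actM hs].
Qed.

Lemma transporter_right s t g : transporter s t g ->
  transporter s t = [set (x * g)%g | x in transporter t t].
Proof.
move=> [G0g gs]; apply/seteqP; split=> [h [G0h hs]|_ [h [G0h hs] <-]].
  exists (h * g^-1)%g; last by rewrite mulgVK.
  by split; [apply: G0M => //; apply: G0V|rewrite actM -gs actK hs].
by split; [apply: G0M|rewrite actM gs].
Qed.

Lemma transporter_open s t : open (transporter s t).
Proof.
have [[g st]|/set0P/negP/negPn/eqP ->] := pselect (transporter s t !=set0).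
  by rewrite (transporter_left st); apply: open_translate.
exact: open0.
Qed.

Lemma haar_transporter s t g : transporter s t g ->
  mu (transporter s t) = mu (transporter s s) /\
  mu (transporter s t) = mu (transporter t t).
Proof.
move=> st; case: mu_haar => _ _ left_inv; split.
  by rewrite (transporter_left st) left_inv //; apply: open_borel.
by rewrite (transporter_right st) mu_right //; apply: open_borel.
Qed.

Definition same_orbit s t : bool := `[< transporter s t !=set0 >].

Let stab_haar s : mu (transporter s s) = ((weight s)^-1)%:E.
Proof.
rewrite invrK fineK // ge0_fin_numE ?measure_ge0 //.
exact: haar_compact_lt_pinfty.
Qed.

Lemma weight_gt0 s : (0 < weight s)%R.
Proof.
rewrite -invr_gt0 -lte_fin -stab_haar; apply: haar_open_gt0 => //.
by exists 1%g; split.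
Qed.

Let haar_same_orbit s t :
  mu (transporter s t) = ((same_orbit s t)%:R * (weight s)^-1)%:E.
Proof.
rewrite /same_orbit; case: asboolP => [[g st]|/set0P/negP/negPn/eqP ->].
  by rewrite mul1r -stab_haar; case: (haar_transporter st).
by rewrite mul0r measure0.
Qed.

Lemma haar_transporter_sum s (A : {fset C}) :
  mu (\big[setU/set0]_(t <- A) transporter s t) =
  (\sum_(t <- A) (same_orbit s t)%:R * (weight s)^-1)%:E.
Proof.
rewrite (measure_fbigsetU mu).
- by rewrite -sumEFin; apply: eq_bigr => t _; apply: haar_same_orbit.
- by move=> t _; apply: open_borel; apply: transporter_open.
by move=> t u _ _ [g [[_ <-] [_ <-]]].
Qed.

Section MassTransport.
Variable cl : C -> {fset C}.
Hypotheses (cl_refl : forall s, s \in cl s)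
  (cl_eq : forall s t, t \in cl s -> cl t = cl s)
  (cl_act : forall g s, G0 g -> cl (act g s) = (act g @` cl s)%fset).

Let cl_sym s t : (s \in cl t) = (t \in cl s).
Proof. by apply/idP/idP => /cl_eq e; rewrite -?e ?cl_refl // e cl_refl. Qed.

Local Open Scope ring_scope.

(** The elements carrying [r] into the class of [s], counted according to the
    image of [r] and to the preimage of [s]: the two counts agree because the
    measure is invariant on both sides. *)
Lemma class_orbit_count r s :
  (\sum_(t <- cl s) (same_orbit r t)%:R) * (weight r)^-1 =
  (\sum_(t <- cl r) (same_orbit s t)%:R) * (weight s)^-1 :> R.
Proof.
have sym t : same_orbit s t = same_orbit t s.
  apply/asboolP/asboolP => -[g [G0g <-]]; exists g^-1%g; split; rewrite ?actK //;
  exact: G0V.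
rewrite !mulr_suml; apply: EFin_inj; rewrite -haar_transporter_sum.
transitivity (mu (\big[setU/set0]_(t <- cl r) transporter t s)).
  congr (mu _); rewrite -!bigcup_fset; apply/seteqP.
  split=> [g [t ts [G0g gr]]|g [t tr [G0g gs]]].
    exists (act g^-1%g s); last by split; rewrite // actVK.
    rewrite /= -[r](actK g) gr cl_act; last exact: G0V.
    by apply: in_imfset; rewrite /= cl_sym.
  exists (act g r); last by split.
  rewrite /= -gs cl_act //; apply: in_imfset.
  by rewrite /= cl_sym.
rewrite (measure_fbigsetU mu).
- rewrite -sumEFin; apply: eq_bigr => t _; rewrite sym /same_orbit.
  case: asboolP => [[g st]|/set0P/negP/negPn/eqP ->]; last by rewrite mul0r measure0.
  by rewrite mul1r -stab_haar; case: (haar_transporter st).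
- by move=> t _; apply: open_borel; apply: transporter_open.
- move=> t u _ _ [g [[_ gt] [_ gu]]].
  by rewrite -(actK g t) gt -gu actK.
Qed.

(** Mass transport: spread the weight of each chamber evenly over its class; by
    the count above, each orbit receives as much as it sends. *)
Lemma weight_locally_averaged (reps : seq C) : uniq reps ->
  (forall s t, s \in reps -> t \in reps -> same_orbit s t -> s = t) ->
  (forall t, exists g s, [/\ G0 g, s \in reps & t = act g s]) ->
  locally_averaged G0 act reps weight cl.
Proof.
move=> reps_uniq reps_inj reps_cover F F_inv.
have orbit_sum (f : C -> R) t : (forall g s, G0 g -> f (act g s) = f s) ->
    f t = \sum_(r <- reps) f r * (same_orbit r t)%:R.
  move=> f_inv; have [g [s [G0g sr ->]]] := reps_cover t.
  rewrite (bigD1_seq s) //= (_ : same_orbit s (act g s) = true); last first.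
    by apply/asboolP; exists g; split.
  rewrite mulr1 f_inv // big_seq_cond big1 ?addr0 // => r /andP[rr rs].
  rewrite /same_orbit; case: asboolP => [[h [G0h hr]]|_]; last by rewrite mulr0.
  case/eqP: rs; apply: (reps_inj r s) => //; apply/asboolP; exists (g^-1 * h)%g.
  by split; [apply: G0M => //; apply: G0V|rewrite actM hr actK].
have card0 s : (#|` cl s|)%:R != 0 :> R.
  by rewrite pnatr_eq0 cardfs_eq0; apply/fset0Pn; exists s; apply: cl_refl.
have w0 s : weight s != 0 by rewrite gt_eqF ?weight_gt0.
pose k s r : R := \sum_(t <- cl s) (same_orbit r t)%:R.
have wk s r : weight s * k s r = weight r * k r s.
  apply: (mulIf (invr_neq0 (w0 r))); rewrite -mulrA [k s r / _]class_orbit_count.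
  by rewrite -/(k r s); field; rewrite !w0.
have swap s r : weight s * ((#|` cl s|)%:R^-1 * k s r) =
    weight r * ((#|` cl r|)%:R^-1 * k r s).
  rewrite mulrCA wk [RHS]mulrCA.
  have [kr0|kr0] := eqVneq (k r s) 0; first by rewrite kr0 !mulr0.
  congr (_^-1 * _).
  have [t ts [g [G0g gr]]] : exists2 t, t \in cl s & transporter r t !=set0.
    apply: contrapT => no; case/eqP: kr0; apply: (mulfI (w0 r)); rewrite mulr0 -wk.
    rewrite [k s r]big_seq big1 ?mulr0 // => t ts.
    by rewrite /same_orbit; case: asboolP => // rt; case: no; exists t.
  by rewrite -(cl_eq ts) -gr cl_act // card_imfset //; apply: can_inj (actK g).
transitivity (\sum_(s <- reps) \sum_(r <- reps) F r *
    (weight s * ((#|` cl s|)%:R^-1 * k s r))).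
  rewrite exchange_big /=; apply: eq_bigr => r _.
  rewrite -mulr_sumr mulrC; congr (_ * _).
  under eq_bigr => s _ do rewrite swap.
  rewrite -!mulr_sumr exchange_big /=.
  rewrite (eq_bigr (fun=> 1)) => [|t _]; last first.
    by rewrite [RHS](orbit_sum (fun=> 1) t) //; apply: eq_bigr => s _; rewrite mul1r.
  by rewrite big_const_seq count_predT iter_addr_0 mulVf ?mulr1.
apply: eq_bigr => s _; under eq_bigr => r _ do rewrite 2!(mulrCA (F r)).
rewrite -!mulr_sumr; congr (_ * (_ * _)); under eq_bigr => r _ do rewrite mulr_sumr.
by rewrite exchange_big /=; apply: eq_bigr => t _; rewrite -orbit_sum.
Qed.

End MassTransport.
End Orbits.
End HaarMeasure.

(** * Chambers and their faces *)

Section Chambers.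
Variables (V : choiceType) (X : set {fset V}) (n : nat) (part : V -> 'I_n.+1).
Hypotheses (X_pure : pure_dimensional X n) (X_partite : partite X part).

Local Notation cham := (simplices X n%:Z).
Implicit Types (J : {set 'I_n.+1}) (s t : {fset V}).

Lemma chamber_card s : cham s -> #|` s| = n.+1.
Proof. by move=> [_ /eqP]; rewrite -PoszD addn1 eqz_nat => /eqP. Qed.

Lemma chamber_vertex_exists s (i : 'I_n.+1) : cham s -> exists2 v, v \in s & part v = i.
Proof.
move=> sc; have /eqP/cardfs1P[v sv] := X_partite sc i.
have : v \in [fset v in s | part v == i]%fset by rewrite sv inE.
by rewrite !inE => /andP[vs /eqP]; exists v.
Qed.

Lemma chamber_vertex_unique s u v : cham s -> u \in s -> v \in s ->
  part u = part v -> u = v.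
Proof.
move=> sc us vs uv; have /eqP/cardfs1P[w sw] := X_partite sc (part u).
have : u \in [fset x in s | part x == part u]%fset by rewrite !inE us eqxx.
have : v \in [fset x in s | part x == part u]%fset by rewrite !inE vs uv eqxx.
by rewrite sw !inE => /eqP -> /eqP ->.
Qed.

Lemma simplex_in_chamber s : X s -> exists2 t, cham t & (s `<=` t)%fset.
Proof. by case: X_pure => _ _; apply. Qed.

Lemma subsimplex s t : X s -> (t `<=` s)%fset -> X t.
Proof. by case: X_pure => X_down _ _; apply: X_down. Qed.

Definition face (J : {set 'I_n.+1}) (s : {fset V}) : {fset V} :=
  [fset v in s | part v \notin J]%fset.

Lemma in_face J s v : (v \in face J s) = (v \in s) && (part v \notin J).
Proof. by rewrite !inE. Qed.

Lemma face_sub J s : (face J s `<=` s)%fset.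
Proof. by apply/fsubsetP => v; rewrite in_face => /andP[]. Qed.

Lemma face_eqP J s t : cham s -> cham t ->
  (forall v, v \in s -> part v \notin J -> v \in t) -> face J t = face J s.
Proof.
move=> sc tc st; apply/fsetP => v; rewrite !in_face.
case: (boolP (part v \in J)) => vJ; rewrite ?andbF // !andbT.
apply/idP/idP => [vt|vs]; last exact: st.
have [u us uv] := chamber_vertex_exists (part v) sc.
have ut : u \in t by apply: st; rewrite // uv.
by rewrite -(chamber_vertex_unique tc ut vt uv).
Qed.

Lemma face_mem J s t v : face J t = face J s -> v \in s -> part v \notin J -> v \in t.
Proof.
move=> st vs vJ; have : v \in face J s by rewrite in_face vs.
by rewrite -st in_face => /andP[].
Qed.

Lemma face_mono (J J' : {set 'I_n.+1}) s t : J \subset J' -> cham s -> cham t ->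
  face J t = face J s -> face J' t = face J' s.
Proof.
move=> JJ' sc tc st; apply: face_eqP => // v vs vJ'; apply: face_mem st vs _.
by apply: contra vJ'; apply: (fintype.subsetP JJ').
Qed.

Lemma sub_face_eq J s t : cham s -> cham t -> (face J s `<=` t)%fset ->
  face J t = face J s.
Proof.
move=> sc tc /fsubsetP st; apply: face_eqP => // v vs vJ.
by apply: st; rewrite in_face vs.
Qed.

Lemma type_of_face J s : cham s -> type_of part (face J s) = ~: J.
Proof.
move=> sc; apply/setP => i; rewrite !inE; apply/hasP/idP.
  by move=> [v]; rewrite in_face => /andP[_ vJ] /eqP <-.
move=> iJ; have [v vs vi] := chamber_vertex_exists i sc.
by exists v; rewrite ?in_face ?vs ?vi.
Qed.

(** A chamber has one vertex of each type, so counting the vertices of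
    a face amounts to counting types. *)
Lemma card_face J s : cham s -> #|` face J s| = #|~: J|.
Proof.
move=> sc; have -> : #|~: J| = #|` [fset i in ~: J]%fset| by rewrite card_finset.
have -> : [fset i in ~: J]%fset = [fset part v | v in face J s]%fset.
  apply/fsetP => i; rewrite !inE; apply/idP/imfsetP => [iJ|[v /=]].
    have [v vs vi] := chamber_vertex_exists i sc.
    by exists v; rewrite //= in_face vs vi.
  by rewrite in_face => /andP[_ vJ] ->.
rewrite [RHS]card_in_imfset //= => u v /=; rewrite !in_face => /andP[us _] /andP[vs _].
exact: (chamber_vertex_unique sc).
Qed.

Lemma face_simplex2 i j s : i != j -> cham s ->
  simplices X (n%:Z - 2) (face [set i; j] s).
Proof.
move=> ij sc; split; first exact: (subsimplex sc.1 (face_sub _ _)).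
rewrite card_face //; have := cardsC [set i; j].
rewrite cards2 ij card_ord /=; lia.
Qed.

Lemma type_of_face_of_chamber (J : {set 'I_n.+1}) s : X s -> type_of part s = ~: J ->
  exists2 t, cham t & face J t = s.
Proof.
move=> Xs sJ; have [t tc st] := simplex_in_chamber Xs.
exists t => //; apply/fsetP => v; rewrite in_face; apply/andP/idP => [[vt vJ]|vs].
  have : part v \in type_of part s by rewrite sJ inE.
  rewrite inE => /hasP[u us /eqP uv].
  by rewrite -(chamber_vertex_unique tc (fsubsetP st _ us) vt uv).
split; first exact: (fsubsetP st).
have : part v \in type_of part s by rewrite inE; apply/hasP; exists v.
by rewrite sJ inE.
Qed.

Lemma adjacent_chambers_face s t : cham s -> cham t ->
  simplices X (n%:Z - 1) (s `&` t)%fset -> exists i, face [set i] t = face [set i] s.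
Proof.
move=> sc tc [_ /eqP]; rewrite subrK eqz_nat => /eqP st.
have : #|` (s `\` t)%fset| = 1%N.
  have := cardfsID t s; rewrite st (chamber_card sc); lia.
move/eqP/cardfs1P => [w sw]; exists (part w); apply: face_eqP => // v vs.
rewrite inE; apply: contraR => vt.
have : v \in (s `\` t)%fset by rewrite inE vt.
by rewrite sw inE => /eqP ->.
Qed.

End Chambers.

Section ChamberType.
Variables (V : choiceType) (X : set {fset V}) (n : nat).

Definition chamber := {s : {fset V} | `[< simplices X n%:Z s >]}.

HB.instance Definition _ := Choice.on chamber.

Lemma chamberP (s : chamber) : simplices X n%:Z (val s).
Proof. by case: s => s /= /asboolP. Qed.

Definition mk_chamber s (sc : simplices X n%:Z s) : chamber :=
  exist _ s (introT (asboolP _) sc).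

End ChamberType.

Section Classes.
Variables (V : choiceType) (X : set {fset V}) (n : nat) (part : V -> 'I_n.+1).
Hypotheses (X_pure : pure_dimensional X n) (X_partite : partite X part)
  (X_links : connected_finite_1links X n).

Local Notation C := (chamber X n).
Implicit Types (J : {set 'I_n.+1}) (s t : C).

(** For [J] a pair this set embeds in the link of a codimension two face, hence
    is finite; only finite sets are faithfully encoded. *)
Definition class J s : {fset C} :=
  fset_set [set t : C | face part J (val t) = face part J (val s)].

Lemma finite_class2 i j s : i != j ->
  finite_set [set t : C | face part [set i; j] (val t) = face part [set i; j] (val s)].
Proof.
move=> ij; set eta := face part [set i; j] (val s).
have [Yfin _] := X_links (face_simplex2 X_pure X_partite ij (chamberP s)).
have sub (t : C) : face part [set i; j] (val t) = eta -> (eta `<=` val t)%fset.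
  by move=> <-; apply: face_sub.
apply: sub_finite_set (finite_image (fun y => insubd s (eta `|` y)%fset) Yfin).
move=> t /= te; have et := sub t te.
have tE : (eta `|` (val t `\` eta))%fset = val t.
  apply/fsetP => v; rewrite in_fsetU in_fsetD; case: (boolP (v \in eta)) => //= ve.
  by rewrite (fsubsetP et _ ve).
exists (val t `\` eta)%fset; last by rewrite tE valKd.
split; last by rewrite tE; exact: (chamberP t).1.
- exact: (subsimplex X_pure (chamberP t).1 (fsubsetDl _ _)).
- by apply/fsetP => v; rewrite in_fsetI in_fsetD in_fset0; case: (v \in eta); rewrite ?andbF.
Qed.

Lemma in_class2 i j s t : i != j ->
  (t \in class [set i; j] s) = (face part [set i; j] (val t) == face part [set i; j] (val s)).
Proof.
move=> ij; rewrite in_fset_set; last exact: finite_class2.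
by apply/idP/eqP; rewrite inE.
Qed.

Lemma finite_class1 i s : (0 < n)%N ->
  finite_set [set t : C | face part [set i] (val t) = face part [set i] (val s)].
Proof.
move=> n0; have [j ij] : exists j, i != j.
  have : (1 < #|{: 'I_n.+1}|)%N by rewrite card_ord ltnS.
  move/(fun h => leq_trans h (leqnn _)); rewrite (cardD1 i) inE /= add1n ltnS.
  by case/card_gt0P => j; rewrite !inE andbT eq_sym; exists j.
apply: sub_finite_set (finite_class2 s ij) => t /=.
apply: (face_mono X_partite) (chamberP s) (chamberP t).
by apply/fintype.subsetP => k; rewrite !inE => ->.
Qed.

Lemma in_class1 i s t : (0 < n)%N ->
  (t \in class [set i] s) = (face part [set i] (val t) == face part [set i] (val s)).
Proof.
move=> n0; rewrite in_fset_set; last exact: finite_class1.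
by apply/idP/eqP; rewrite inE.
Qed.

End Classes.

Section Action.
Variables (V : choiceType) (X : set {fset V}) (n : nat) (part : V -> 'I_n.+1).
Hypotheses (X_pure : pure_dimensional X n) (X_partite : partite X part).
Variables (G : topologicalGroupType) (act : G -> V -> V).
Hypothesis G_acts : simplicial_action X act.

Local Notation C := (chamber X n).
Implicit Types (J : {set 'I_n.+1}).

Lemma vertex_act1 v : act 1%g v = v.
Proof. by case: G_acts. Qed.

Lemma vertex_actM g h v : act (g * h)%g v = act g (act h v).
Proof. by case: G_acts. Qed.

Lemma vertex_actK g : cancel (act g) (act g^-1%g).
Proof. by move=> v; rewrite -vertex_actM mulVg vertex_act1. Qed.

Lemma vertex_actVK g : cancel (act g^-1%g) (act g).
Proof. by move=> v; rewrite -vertex_actM mulgV vertex_act1. Qed.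

Lemma mem_act_simplex g s v : (act g v \in act_simplex act g s) = (v \in s).
Proof. by rewrite /act_simplex mem_imfset //; apply: can_inj (vertex_actK g). Qed.

Lemma mem_act_simplexV g s v : (v \in act_simplex act g s) = (act g^-1%g v \in s).
Proof. by rewrite -{1}(vertex_actVK g v) mem_act_simplex. Qed.

Lemma simplex_act g s : X s -> X (act_simplex act g s).
Proof. by case: G_acts => _ _; apply. Qed.

Lemma vertex_act g v : X [fset v]%fset -> X [fset act g v]%fset.
Proof.
move/(simplex_act g); congr X; apply/fsetP => u.
by rewrite mem_act_simplexV !in_fset1 (can2_eq (vertex_actVK g) (vertex_actK g)).
Qed.

Lemma act_simplex1 s : act_simplex act 1%g s = s.
Proof. by apply/fsetP => v; rewrite mem_act_simplexV invg1 vertex_act1. Qed.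

Lemma act_simplexM g h s :
  act_simplex act (g * h)%g s = act_simplex act g (act_simplex act h s).
Proof. by apply/fsetP => v; rewrite !mem_act_simplexV invgM vertex_actM. Qed.

Lemma chamber_act_proof g (s : C) : simplices X n%:Z (act_simplex act g (val s)).
Proof.
have [Xs sn] := chamberP s; split; first exact: simplex_act.
by rewrite card_imfset //; apply: can_inj (vertex_actK g).
Qed.

Definition chamber_act g (s : C) : C := mk_chamber (chamber_act_proof g s).

Lemma chamber_act1 s : chamber_act 1%g s = s.
Proof. by apply: val_inj; apply: act_simplex1. Qed.

Lemma chamber_actM g h s :
  chamber_act (g * h)%g s = chamber_act g (chamber_act h s).
Proof. by apply: val_inj; apply: act_simplexM. Qed.

Definition type_preserving : set G :=
  [set g | forall v, X [fset v]%fset -> part (act g v) = part v].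

Lemma type_preserving1 : type_preserving 1%g.
Proof. by move=> v _; rewrite vertex_act1. Qed.

Lemma type_preservingM g h :
  type_preserving g -> type_preserving h -> type_preserving (g * h)%g.
Proof. by move=> gP hP v Xv; rewrite vertex_actM gP ?hP //; apply: vertex_act. Qed.

Lemma type_preservingV g : type_preserving g -> type_preserving g^-1%g.
Proof.
by move=> gP v Xv; rewrite -{2}(vertex_actVK g v) gP //; apply: vertex_act.
Qed.

Lemma simplex_vertex s v : X s -> v \in s -> X [fset v]%fset.
Proof. by move=> Xs vs; apply: (subsimplex X_pure Xs); rewrite fsub1set. Qed.

Lemma face_act J g (s : C) : type_preserving g ->
  face part J (act_simplex act g (val s)) = act_simplex act g (face part J (val s)).
Proof.
move=> gP; apply/fsetP => v; rewrite mem_act_simplexV !in_face mem_act_simplexV.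
case: (boolP (_ \in val s)) => //= vs.
rewrite -{1}(vertex_actVK g v) gP //; exact: simplex_vertex (chamberP s).1 vs.
Qed.

Lemma class_act J g (s : C) : type_preserving g ->
  (forall s : C, finite_set [set t : C | face part J (val t) = face part J (val s)]) ->
  class part J (chamber_act g s) = (chamber_act g @` class part J s)%fset.
Proof.
move=> gP fin; have gVP := type_preservingV gP.
have inj : injective (fun s => act_simplex act g s).
  by move=> a b /(congr1 (act_simplex act g^-1%g)); rewrite -!act_simplexM mulVg !act_simplex1.
apply/fsetP => t; rewrite in_fset_set ?fin //; apply/idP/imfsetP.
  rewrite inE /= face_act // => te.
  exists (chamber_act g^-1%g t); last by rewrite -chamber_actM mulgV chamber_act1.
  rewrite /= in_fset_set ?fin // inE /=; apply: inj.
  rewrite -te -[act_simplex act g^-1%g _]/(val (chamber_act g^-1%g t)) -face_act //=.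
  by rewrite -act_simplexM mulgV act_simplex1.
move=> [u /=]; rewrite in_fset_set ?fin // inE /= => ue ->.
by rewrite inE /= !face_act // ue.
Qed.

End Action.

(** * The type-preserving subgroup *)

Section TypePreserving.
Variables (V : choiceType) (X : set {fset V}) (n : nat) (part : V -> 'I_n.+1).
Hypotheses (X_pure : pure_dimensional X n) (X_partite : partite X part)
  (X_gallery : gallery_connected X n).
Variables (G : topologicalGroupType) (act : G -> V -> V).
Hypothesis G_acts : simplicial_action X act.

Local Notation C := (chamber X n).
Local Notation gact := (chamber_act G_acts).
Local Notation G0 := (type_preserving X part act).

Lemma chamber_inhabited : exists s : C, True.
Proof.
by case: X_pure => _ [_ [s sc]] _; exists (mk_chamber sc).
Qed.

Lemma chamber_ind (P : C -> Prop) (s0 : C) : P s0 ->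
  (forall s t i, P s -> face part [set i] (val t) = face part [set i] (val s) -> P t) ->
  forall t, P t.
Proof.
move=> P0 step t; have [l [c [c0 cl cc cadj]]] := X_gallery (chamberP s0) (chamberP t).
have : forall k (kl : (k <= l)%N), P (mk_chamber (cc k kl)).
  elim=> [|k IH] kl.
    by rewrite (_ : mk_chamber _ = s0) //; apply: val_inj; rewrite /= c0.
  have kl' := ltnW kl.
  have [i ie] := adjacent_chambers_face X_partite (cc _ kl') (cc _ kl) (cadj _ kl).
  exact: (step _ (mk_chamber (cc k.+1 kl)) i (IH kl') ie).
by move/(_ l (leqnn l)); rewrite (_ : mk_chamber _ = t) //; apply: val_inj; rewrite /= cl.
Qed.

(** Crossing a facet replaces one vertex by another of the same type, so the
    permutation of the types that an automorphism induces on one chamber is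
    the one that it induces on every chamber of a gallery. *)
Lemma type_permutation g : exists f : 'I_n.+1 -> 'I_n.+1, injective f /\
  forall v, X [fset v]%fset -> part (act g v) = f (part v).
Proof.
have [s0 _] := chamber_inhabited.
have gs (s : C) := chamberP (gact g s).
have /choice[vtx vtxP] : forall i, exists v, v \in val s0 /\ part v = i.
  by move=> i; have [v vs vi] := chamber_vertex_exists X_partite i (chamberP s0); exists v.
pose f i := part (act g (vtx i)).
have f_inj : injective f.
  move=> i j fij; have [[vi <-] [vj <-]] := (vtxP i, vtxP j); congr part.
  apply: (can_inj (vertex_actK G_acts g)).
  by apply: (chamber_vertex_unique X_partite (gs s0)) => //; rewrite (mem_act_simplex G_acts).
exists f; split=> //.
suff all_s (s : C) : forall v, v \in val s -> part (act g v) = f (part v).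
  move=> v Xv; have [t tc] := simplex_in_chamber X_pure Xv.
  by rewrite fsub1set; apply: (all_s (mk_chamber tc)).
move: s; apply: (@chamber_ind _ s0).
  move=> v vs; rewrite /f; congr (part (act g _)); have [ws wp] := vtxP (part v).
  by apply: (chamber_vertex_unique X_partite (chamberP s0)).
move=> s t i IH ti v vt.
have st w : w \in val s -> part w != i -> w \in val t.
  by move=> ws wi; apply: (face_mem ti) => //; rewrite inE.
have ts w : w \in val t -> part w != i -> w \in val s.
  by move=> wt wi; apply: (face_mem (esym ti)) => //; rewrite inE.
have [vi|vi] := eqVneq (part v) i; last exact/IH/ts.
have [u] := chamber_vertex_exists X_partite (part (act g v)) (gs s).
rewrite (mem_act_simplexV G_acts) => us uE.
have uP : part (act g v) = f (part (act g^-1%g u)).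
  by rewrite -IH // (vertex_actVK G_acts).
rewrite uP; have [-> //|ui] := eqVneq (part (act g^-1%g u)) (part v).
have ut : act g^-1%g u \in val t by apply: st; rewrite // -vi.
case/eqP: ui; congr part; apply: (can_inj (vertex_actK G_acts g)).
apply: (chamber_vertex_unique X_partite (gs t)); rewrite ?(mem_act_simplex G_acts) //.
by rewrite (vertex_actVK G_acts).
Qed.

(** Two elements that permute the types in the same way differ by a
    type-preserving one. *)
Lemma finite_index : exists D : seq G, forall g, exists2 d, d \in D & G0 (d^-1 * g)%g.
Proof.
have /choice[F FP] := type_permutation.
pose S (p : {ffun 'I_n.+1 -> 'I_n.+1}) := [set g | finfun (F g) = p].
exists [seq xget 1%g (S p) | p <- enum {ffun 'I_n.+1 -> 'I_n.+1}] => g.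
pose d := xget 1%g (S (finfun (F g))); exists d.
  by apply/mapP; exists (finfun (F g)); rewrite ?mem_enum.
have dE : finfun (F d) = finfun (F g) by apply: (@xgetI _ 1%g (S (finfun (F g))) g).
have Fd i : F d i = F g i by rewrite -!(ffunE (F _)) dE.
move=> v Xv; rewrite (vertex_actM G_acts); have [Fd_inj dP] := FP d.
have [_ gP] := FP g; apply: Fd_inj; rewrite -dP.
  by rewrite (vertex_actVK G_acts) gP.
by do 2!apply: (vertex_act G_acts).
Qed.

Lemma orbit_representatives (T : eqType) (E : rel T) (L : seq T) :
  reflexive E -> symmetric E -> transitive E ->
  exists reps : seq T, [/\ uniq reps, {subset reps <= L},
    forall x, x \in L -> exists2 r, r \in reps & E x r &
    forall r r', r \in reps -> r' \in reps -> E r r' -> r = r'].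
Proof.
move=> Er Es Et; elim: L => [|x L [reps [ru rL cov ineq]]]; first by exists [::].
have [/hasP[r rr xr]|nh] := boolP (has (E x) reps).
  exists reps; split=> // y; first by move/rL; rewrite inE orbC => ->.
  by rewrite inE => /predU1P[->|/cov//]; exists r.
exists (x :: reps); split=> [|y|y|y z].
- by rewrite /= ru andbT; apply: contra nh => xr; apply/hasP; exists x.
- by rewrite !inE => /predU1P[->|/rL ->]; rewrite ?eqxx ?orbT.
- rewrite inE => /predU1P[->|/cov[r rr yr]]; first by exists x; rewrite ?inE ?eqxx.
  by exists r; rewrite // inE rr orbT.
have no w : w \in reps -> ~~ E x w by apply/hasPn.
rewrite !inE => /predU1P[->|yr] /predU1P[->|zr] //; last exact: ineq.
  by rewrite (negPf (no _ zr)).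
by rewrite Es (negPf (no _ yr)).
Qed.

Hypothesis G_cocompact : cocompact X act.

(** By the finite index, each orbit of the whole group splits into finitely many
    orbits of the type-preserving subgroup. *)
Lemma finite_orbit_representatives : exists reps : seq C,
  [/\ uniq reps,
    forall s t, s \in reps -> t \in reps -> same_orbit G0 gact s t -> s = t &
    forall t, exists g s, [/\ G0 g, s \in reps & t = gact g s]].
Proof.
have [D DP] := finite_index; have [s0 _] := chamber_inhabited.
have /finite_seqP[Os OsE] := G_cocompact.
pose pick_chamber (o : set {fset V}) : C := xget s0 [set t : C | o (val t)].
pose L := [seq gact d^-1%g r | d <- D, r <- map pick_chamber Os].
have LP t : exists g s, [/\ G0 g, s \in L & t = gact g s].
  pose o := orbit_of act (val t).
  have oO : o \in Os.
    suff : [set` Os] o by [].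
    by rewrite -OsE; exists (val t) => //; exact: (chamberP t).1.
  have [g _ gtE] : o (val (pick_chamber o)).
    apply: (@xgetPex _ s0 [set t : C | o (val t)]).
    by exists t; exists 1%g => //; rewrite (act_simplex1 G_acts).
  have rE : pick_chamber o = gact g t by apply: val_inj; rewrite /= gtE.
  have [d dD dg] := DP g.
  exists (g^-1 * d)%g, (gact d^-1%g (pick_chamber o)); split.
  - by rewrite -[d]invgK -invgM; apply: type_preservingV.
  - by apply: allpairs_f => //; apply: map_f.
  - by rewrite -chamber_actM -mulgA mulgV mulg1 rE -chamber_actM mulVg chamber_act1.
pose E (s t : C) := same_orbit G0 gact s t.
have [|||reps [ru _ cov ineq]] := @orbit_representatives _ E L.
- by move=> s; apply/asboolP; exists 1%g; split; [exact: type_preserving1|exact: chamber_act1].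
- have symm (s t : C) : E s t -> E t s.
    move=> /asboolP[g [G0g <-]]; apply/asboolP; exists g^-1%g; split.
      exact: type_preservingV.
    by rewrite -chamber_actM mulVg chamber_act1.
  by move=> s t; apply/idP/idP; apply: symm.
- move=> t s u /asboolP[g [G0g <-]] /asboolP[h [G0h <-]]; apply/asboolP.
  by exists (h * g)%g; split; [exact: type_preservingM|exact: chamber_actM].
exists reps; split=> // t; have [g [s [G0g sL ->]]] := LP t.
have [r rr /asboolP[h [G0h hs]]] := cov _ sL.
exists (g * h^-1)%g, r; split=> //.
  by apply: type_preservingM => //; apply: type_preservingV.
by rewrite -hs -chamber_actM -mulgA mulVg mulg1.
Qed.

Hypotheses (G_hausdorff : hausdorff_space G)
  (G_stab : forall s : {fset V},
     simplices X (n%:Z - 1) s \/ simplices X n%:Z s ->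
     open (stabilizer act s) /\ compact (stabilizer act s)).

(** A type-preserving element stabilizing a chamber fixes its vertices, hence
    stabilizes its facets; an element stabilizing a chamber and its facets fixes
    the vertices, so it induces the trivial permutation of the types.  The right
    hand side is open and compact. *)
Lemma type_preserving_stabilizer (s : C) : transporter G0 gact s s =
  stabilizer act (val s) `&`
  \bigcap_(v in [set` val s]) stabilizer act (val s `\ v)%fset.
Proof.
apply/seteqP; split=> [g [G0g gs]|g [gs gv]].
  have gsE : act_simplex act g (val s) = val s by rewrite -{2}gs.
  have fixv v : v \in val s -> act g v = v.
    move=> vs; apply: (chamber_vertex_unique X_partite (chamberP s)) => //.
      by rewrite -gsE (mem_act_simplex G_acts).
    by apply: G0g; apply: (simplex_vertex X_pure (chamberP s).1).
  split=> // v vs; apply/fsetP => w; rewrite (mem_act_simplexV G_acts) !in_fsetD1.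
  rewrite -[act g^-1%g w \in _](mem_act_simplex G_acts g) (vertex_actVK G_acts) gsE.
  case: (boolP (w \in val s)); rewrite ?andbF ?andbT // => ws; congr (~~ _).
  by rewrite (can2_eq (vertex_actVK G_acts g) (vertex_actK G_acts g)) fixv.
have fixv v : v \in val s -> act g v = v.
  move=> vs; apply/eqP; apply: contraT => gvv.
  have gvs : act g v \in val s by rewrite -gs (mem_act_simplex G_acts).
  have : act g v \in (val s `\ v)%fset by rewrite in_fsetD1 gvv.
  by rewrite -(gv v vs) (mem_act_simplex G_acts) in_fsetD1 eqxx.
split; last by apply: val_inj.
have [f [_ fP]] := type_permutation g.
move=> v Xv; rewrite fP //; have [u us <-] := chamber_vertex_exists X_partite (part v) (chamberP s).
by rewrite -fP ?fixv //; apply: (simplex_vertex X_pure (chamberP s).1).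
Qed.

Lemma facet_simplex (s : C) v : v \in val s -> simplices X (n%:Z - 1) (val s `\ v)%fset.
Proof.
move=> vs; split; first exact: (subsimplex X_pure (chamberP s).1 (fsubsetDl _ _)).
have := cardfsD1 v (val s); rewrite vs (chamber_card (chamberP s)) subrK; lia.
Qed.

Lemma transporter_open_stab (s : C) : open (transporter G0 gact s s).
Proof.
rewrite type_preserving_stabilizer; apply: openI.
  by case: (G_stab (or_intror (chamberP s))).
rewrite bigcap_fset big_seq; apply: big_ind => [|A B|v vs]; [exact: openT|exact: openI|].
by case: (G_stab (or_introl (facet_simplex vs))).
Qed.

Lemma transporter_compact_stab (s : C) : compact (transporter G0 gact s s).
Proof.
rewrite type_preserving_stabilizer.
have [_ sc] := G_stab (or_intror (chamberP s)).
apply: (subclosed_compact _ sc); last exact: subIsetl.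
apply: closedI; first exact: compact_closed.
apply: closed_bigI => v vs; apply: compact_closed => //.
by case: (G_stab (or_introl (facet_simplex vs))).
Qed.

End TypePreserving.

(** * The graph in the link of a codimension two face *)

Section LinkGraph.
Variables (V : choiceType) (X : set {fset V}) (n : nat) (part : V -> 'I_n.+1).
Hypotheses (X_pure : pure_dimensional X n) (X_partite : partite X part)
  (X_links : connected_finite_1links X n).

Local Notation C := (chamber X n).

Variables (s : C) (i j : 'I_n.+1).
Hypothesis ij : i != j.

Local Notation eta := (face part [set i; j] (val s)).
Local Notation Y := (link X eta).
Local Notation T := (vertices Y).
Local Notation e := (@Defs.adjacent V Y).

Let in_class t : (t \in class part [set i; j] s) = (face part [set i; j] (val t) == eta).
Proof. exact: in_class2. Qed.

Let face_sub_chamber (t : C) : face part [set i; j] (val t) = eta -> (eta `<=` val t)%fset.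
Proof. by move=> <-; apply: face_sub. Qed.

Let in_eta_of (t : C) v : face part [set i; j] (val t) = eta -> v \in val t ->
  part v != i -> part v != j -> v \in eta.
Proof. by move=> <- vt vi vj; rewrite in_face vt !inE negb_or vi. Qed.

Let notin_eta v : (part v == i) || (part v == j) -> v \notin eta.
Proof. by move=> vij; rewrite in_face !inE vij andbF. Qed.

Let two_types a b c : (a == i) || (a == j) -> (b == i) || (b == j) ->
  (c == i) || (c == j) -> c != a -> c != b -> a = b.
Proof. by move=> /orP[]/eqP-> /orP[]/eqP-> /orP[]/eqP->; rewrite ?eqxx. Qed.

Lemma link_vertexP v : reflect
  (exists t : C, [/\ face part [set i; j] (val t) = eta, v \in val t &
     (part v == i) || (part v == j)])
  (v \in T).
Proof.
have [Yfin _] := X_links (face_simplex2 X_pure X_partite ij (chamberP s)).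
have fin : finite_set [set v : V | Y [fset v]%fset].
  apply: (@sub_finite_set _ _ [set v | exists2 A, Y A & (v \in A)]).
    by move=> w Yw; exists [fset w]%fset; rewrite ?in_fset1.
  rewrite (_ : mkset _ = \bigcup_(A in Y) [set` A]); last first.
    by apply/seteqP; split=> [w [A ? ?]|w [A ? ?]]; exists A.
  by apply: bigcup_finite => // A _; apply: finite_fset.
apply: (iffP idP) => [|[t [te vt vij]]]; rewrite in_fset_set // inE.
  move=> [_ ev Xev]; have [t tc et] := simplex_in_chamber X_pure Xev.
  have vt : v \in t by apply: (fsubsetP et); rewrite !inE eqxx orbT.
  have te : face part [set i; j] t = eta.
    apply: (sub_face_eq X_partite (chamberP s) tc).
    by apply: fsubset_trans et; apply: fsubsetUl.
  exists (mk_chamber tc); split=> //; apply: contraT; rewrite negb_or => /andP[vi vj].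
  have : v \in (eta `&` [fset v])%fset.
    by rewrite in_fsetI in_fset1 eqxx andbT; apply: (@in_eta_of (mk_chamber tc)).
  by rewrite ev.
split.
- by apply: (subsimplex X_pure (chamberP t).1); rewrite fsub1set.
- apply/eqP; rewrite -/(fdisjoint _ _) fdisjointX1; exact: notin_eta.
- apply: (subsimplex X_pure (chamberP t).1).
  by rewrite fsubUset face_sub_chamber // fsub1set.
Qed.

Let side_other (u v : T) : (part (val u) == i) = (part (val v) != i) <->
  part (val u) != part (val v).
Proof.
have [_ [_ _ uij]] := link_vertexP _ (valP u); have [_ [_ _ vij]] := link_vertexP _ (valP v).
have [ui|ui] := eqVneq (part (val u)) i.
  by rewrite ui eq_sym; case: eqVneq.
have [vi|vi] := eqVneq (part (val v)) i; first by rewrite vi ui; split.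
split=> //; move: uij vij; rewrite (negPf ui) (negPf vi) /= => /eqP -> /eqP ->.
by rewrite eqxx.
Qed.

Lemma link_edgeP (u v : T) : reflect
  (exists t : C, [/\ face part [set i; j] (val t) = eta,
     val u \in val t, val v \in val t & part (val u) != part (val v)])
  (e u v).
Proof.
apply: (iffP (asboolP _)) => [[[_ disj Xuv] card2]|[t [te ut vt uv]]].
  have [t tc et] := simplex_in_chamber X_pure Xuv.
  have ut : val u \in t by apply: (fsubsetP et); rewrite !in_fsetU !in_fset1 eqxx orbT.
  have vt : val v \in t by apply: (fsubsetP et); rewrite !in_fsetU !in_fset1 eqxx !orbT.
  exists (mk_chamber tc); split=> //.
    apply: (sub_face_eq X_partite (chamberP s) tc).
    by apply: fsubset_trans et; apply: fsubsetUl.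
  apply/eqP => uv; move: card2; rewrite (chamber_vertex_unique X_partite tc ut vt uv).
  by rewrite fsetUid cardfs1.
have [_ [_ _ uij]] := link_vertexP _ (valP u); have [_ [_ _ vij]] := link_vertexP _ (valP v).
have uvt : ([fset val u; val v] `<=` val t)%fset.
  by rewrite fsubUset !fsub1set ut vt.
split; last first.
  by rewrite cardfs2 (_ : val u != val v) //; apply: contra uv => /eqP ->.
split.
- exact: (subsimplex X_pure (chamberP t).1 uvt).
- apply/eqP; rewrite -/(fdisjoint _ _) fdisjointXU !fdisjointX1.
  by rewrite !notin_eta.
- apply: (subsimplex X_pure (chamberP t).1).
  by rewrite fsubUset face_sub_chamber.
Qed.

(** For adjacent [u] and [v] the union is a chamber, so the default value [s] of
    [insubd] is then not used. *)
Definition edge_chamber (u v : T) : C := insubd s (eta `|` [fset val u; val v])%fset.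

Lemma edge_chamberC u v : edge_chamber u v = edge_chamber v u.
Proof. by rewrite /edge_chamber [[fset val u; val v]%fset]fsetUC. Qed.

Lemma edge_chamber_eq (u v : T) (t : C) : face part [set i; j] (val t) = eta ->
  val u \in val t -> val v \in val t -> part (val u) != part (val v) ->
  edge_chamber u v = t.
Proof.
move=> te ut vt uv; rewrite /edge_chamber.
suff -> : (eta `|` [fset val u; val v])%fset = val t by rewrite valKd.
have [_ [_ _ uij]] := link_vertexP _ (valP u); have [_ [_ _ vij]] := link_vertexP _ (valP v).
apply/eqP; rewrite eqEfsubset !fsubUset face_sub_chamber // !fsub1set ut vt /=.
apply/fsubsetP => w wt; rewrite in_fsetU in_fset2.
have [wij|] := boolP ((part w == i) || (part w == j)); last first.
  by rewrite negb_or => /andP[wi wj]; rewrite (in_eta_of te wt wi wj).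
have : (part w == part (val u)) || (part w == part (val v)).
  apply: contraT; rewrite negb_or => /andP[wu wv].
  by case/eqP: uv; apply: two_types uij vij wij wu wv.
by move=> /orP[]/eqP/(chamber_vertex_unique X_partite (chamberP t) wt) ->;
  rewrite // eqxx ?orbT.
Qed.

Lemma chamber_link_vertex (t : C) k : face part [set i; j] (val t) = eta ->
  (k == i) || (k == j) -> exists u : T, val u \in val t /\ part (val u) = k.
Proof.
move=> te kij; have [u ut uk] := chamber_vertex_exists X_partite k (chamberP t).
have uT : u \in T by apply/link_vertexP; exists t; rewrite uk.
by exists (FSetSub uT).
Qed.

Lemma edge_chamber_spec (u v : T) : e u v ->
  [/\ face part [set i; j] (val (edge_chamber u v)) = eta,
     val u \in val (edge_chamber u v), val v \in val (edge_chamber u v) &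
     part (val u) != part (val v)].
Proof. by case/link_edgeP => t [te ut vt uv]; rewrite (edge_chamber_eq te). Qed.

Lemma link_type (u : T) : (part (val u) == i) || (part (val u) == j).
Proof. by have [t []] := link_vertexP _ (valP u). Qed.

Lemma link_sym : symmetric e.
Proof. by move=> u v; rewrite /Defs.adjacent fsetUC. Qed.

Lemma link_bipartite (u v : T) : e u v -> (part (val u) == i) = ~~ (part (val v) == i).
Proof. by case/link_edgeP => t [_ _ _ /side_other]. Qed.

Lemma link_degree_gt0 (u : T) : (0 < degree e u)%N.
Proof.
have [t [te ut uij]] := link_vertexP _ (valP u).
pose k := if part (val u) == i then j else i.
have uk : part (val u) != k.
  by rewrite /k; case: ifPn => // /eqP ->.
have [|v [vt vk]] := @chamber_link_vertex t k te; first by rewrite /k; case: ifP; rewrite eqxx ?orbT.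
have uv : e u v by apply/link_edgeP; exists t; rewrite vk.
by apply/card_gt0P; exists v.
Qed.

Lemma link_inhabited : exists u : T, True.
Proof. by have [|u _] := @chamber_link_vertex s i erefl; rewrite ?eqxx //; exists u. Qed.

Let n_gt0 : (0 < n)%N.
Proof.
rewrite lt0n; apply: contra ij => /eqP n0; apply/eqP/ord_inj.
by have := ltn_ord i; have := ltn_ord j; lia.
Qed.

Let class1_class2 k (t t' : C) : (k == i) || (k == j) ->
  face part [set k] (val t') = face part [set k] (val t) ->
  face part [set i; j] (val t') = face part [set i; j] (val t).
Proof.
move=> kij; apply: (face_mono X_partite _ (chamberP t) (chamberP t')).
by apply/fintype.subsetP => l; rewrite !inE => /eqP ->.
Qed.

(** This makes averaging over the chambers of a facet an average over the edges
    at a vertex of the link. *)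
Lemma class1_edges (t : C) (v : T) k : face part [set i; j] (val t) = eta ->
  val v \in val t -> (k == i) || (k == j) -> part (val v) != k ->
  perm_eq (class part [set k] t) [seq edge_chamber v u | u <- enum (e v)].
Proof.
move=> te vt kij vk; apply: uniq_perm; first exact: fset_uniq.
  rewrite map_inj_in_uniq ?enum_uniq // => u u'; rewrite !mem_enum => vu vu' uu'.
  have [_ _ ut vu1] := edge_chamber_spec vu.
  have [_ _ u't vu2] := edge_chamber_spec vu'.
  apply: val_inj; rewrite uu' in ut.
  apply: (chamber_vertex_unique X_partite (chamberP _) ut u't).
  exact: two_types (link_type u) (link_type u') (link_type v) vu1 vu2.
move=> t'; rewrite in_class1 //; apply/eqP/mapP => [t't|[u]].
  have t'e : face part [set i; j] (val t') = eta by rewrite (class1_class2 kij t't).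
  have vt' : val v \in val t' by apply: (face_mem t't) => //; rewrite inE.
  have [u [ut' uk]] := chamber_link_vertex t'e kij; exists u; last first.
    by rewrite (edge_chamber_eq t'e) // uk.
  by rewrite mem_enum; apply/link_edgeP; exists t'; rewrite uk.
rewrite mem_enum => /edge_chamber_spec[ue vu uu vu'] ->.
apply: (face_eqP X_partite (chamberP t) (chamberP _)) => w wt; rewrite inE => wk.
have [wij|] := boolP ((part w == i) || (part w == j)); last first.
  rewrite negb_or => /andP[wi wj]; apply: (fsubsetP (face_sub_chamber ue)).
  exact: in_eta_of te wt wi wj.
have -> // : w = val v.
apply: (chamber_vertex_unique X_partite (chamberP t)) => //.
by apply: two_types wij (link_type v) kij _ _; rewrite eq_sym.
Qed.

Lemma class2_edges : perm_eq (class part [set i; j] s)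
  [seq edge_chamber u v | u <- enum [pred u : T | part (val u) == i], v <- enum (e u)].
Proof.
apply: uniq_perm; first exact: fset_uniq.
  apply: allpairs_uniq_dep => [|u _|]; [exact: enum_uniq|exact: enum_uniq|].
  move=> _ _ /allpairsPdep[u [v [+ + ->]]] /allpairsPdep[u' [v' [+ + ->]]] /=.
  rewrite !mem_enum => ui uv ui' uv' ee; rewrite !unfold_in /= in ui ui'.
  have [_ ut vt uv1] := edge_chamber_spec uv.
  have [_ ut' vt' uv2] := edge_chamber_spec uv'.
  rewrite ee in ut vt.
  have uu : u = u'.
    apply: val_inj; apply: (chamber_vertex_unique X_partite (chamberP _) ut ut').
    by rewrite (eqP ui) (eqP ui').
  have vv : v = v'.
    apply: val_inj; apply: (chamber_vertex_unique X_partite (chamberP _) vt vt').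
    rewrite (eqP ui) in uv1; rewrite (eqP ui') in uv2.
    by apply: two_types (link_type v) (link_type v') _ uv1 uv2; rewrite eqxx.
  by rewrite uu vv.
move=> t; rewrite in_class; apply/eqP/allpairsPdep => [te|[u [v [ui uv ->]]]].
  have [|u [ut ui]] := chamber_link_vertex te (k := i); first by rewrite eqxx.
  have [|v [vt vj]] := chamber_link_vertex te (k := j); first by rewrite eqxx orbT.
  exists u, v; rewrite !mem_enum; split; first by rewrite unfold_in /= ui.
    by apply/link_edgeP; exists t; rewrite ui vj.
  by rewrite (edge_chamber_eq te) // ui vj.
by rewrite mem_enum in uv; case: (edge_chamber_spec uv).
Qed.

Variables (R : realType) (H : completeNormedModType R[i]) (ip : {dot H for Num.conj}).

Local Notation coproj := (coproj (fun k => class part [set k])).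
Local Notation proj := (proj (fun k => class part [set k])).

Let edge_fun (phi : C -> H) (u v : T) : H := if e u v then phi (edge_chamber u v) else 0.

Lemma proj_avg (phi : C -> H) (t : C) (v : T) k :
  face part [set i; j] (val t) = eta -> val v \in val t ->
  (k == i) || (k == j) -> part (val v) != k ->
  proj k phi t = avg e (edge_fun phi) v.
Proof.
move=> te vt kij vk; have edges := class1_edges te vt kij vk.
rewrite /proj /avg (perm_size edges) size_map -cardE (perm_big _ edges) big_map.
rewrite big_enum; congr (_ *: _); apply: eq_bigr => u vu.
by rewrite /edge_fun (vu : e v u).
Qed.

(** The chambers through the face are the edges of its link, and the two
    projections average at one end or at the other end of the edges. *)
Lemma class2_angle (kappa t : R) (phi : C -> H) :
  second_eigenvalue R e <= kappa -> 0 <= kappa -> 0 < t ->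
  - (kappa / 2) * (t * (\sum_(u <- class part [set i; j] s)
        rip ip (coproj i phi u) (coproj i phi u)) +
      t^-1 * (\sum_(u <- class part [set i; j] s)
        rip ip (coproj j phi u) (coproj j phi u))) <=
  \sum_(u <- class part [set i; j] s) rip ip (coproj i phi u) (coproj j phi u).
Proof.
move=> le_kappa kappa0 t0; have [v0 _] := link_inhabited.
pose f := edge_fun phi; pose S (u : T) := part (val u) == i.
have f_sym u v : f u v = f v u.
  by rewrite /f /edge_fun link_sym edge_chamberC.
have sumE (F : C -> R) (F' : T -> T -> R) :
    (forall u v, S u -> e u v -> F (edge_chamber u v) = F' u v) ->
    \sum_(u <- class part [set i; j] s) F u = \sum_(u | S u) \sum_(v | e u v) F' u v.
  move=> FF'; rewrite (perm_big _ class2_edges) big_allpairs_dep big_enum /=.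
  apply: eq_bigr => u Su; rewrite big_enum; apply: eq_bigr => v uv; exact: FF'.
have ci u v : S u -> e u v -> coproj i phi (edge_chamber u v) = f u v - avg e f v.
  move=> /eqP Su uv; have [te ut vt uv'] := edge_chamber_spec uv.
  rewrite /coproj (proj_avg phi te vt) ?eqxx //; last by rewrite eq_sym; rewrite Su in uv'.
  by rewrite /f /edge_fun uv.
have cj u v : S u -> e u v -> coproj j phi (edge_chamber u v) = f u v - avg e f u.
  move=> /eqP Su uv; have [te ut vt uv'] := edge_chamber_spec uv.
  rewrite /coproj (proj_avg phi te ut) ?eqxx ?orbT ?Su //.
  by rewrite /f /edge_fun uv.
have := @bipartite_edge_angle _ _ e S link_sym link_degree_gt0 link_bipartite H ip
  kappa t f kappa0 t0 (rw_eigenvalues_cases v0 link_sym link_degree_gt0 link_bipartite le_kappa) f_sym.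
have E k l F' := sumE (fun u => rip ip (coproj k phi u) (coproj l phi u)) F'.
rewrite -(E i i) => [|u v Su uv]; last by rewrite ci.
rewrite -(E j j) => [|u v Su uv]; last by rewrite cj.
by rewrite -(E i j) => [|u v Su uv]; last by rewrite ci ?cj.
Qed.

End LinkGraph.

(** * The matrix of link eigenvalues *)

Lemma quadratic_form_sum (R : realType) m (A : 'M[R]_m) (x y : 'cV[R]_m) :
  (x^T *m A *m y) 0 0 = \sum_i \sum_j x i 0 * A i j * y j 0.
Proof.
rewrite mxE exchange_big; apply: eq_bigr => j _.
by rewrite mxE mulr_suml; apply: eq_bigr => i _; rewrite mxE.
Qed.

(** Expanding the form at [x - M^-1 A^-1 x] bounds it below by [M^-1 |x|^2] as
    soon as [M] bounds the inverse form. *)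
Lemma positive_definite_gap (R : realType) m (A : 'M[R]_m) : positive_definite A ->
  exists2 c : R, 0 < c <= 1 &
    forall x : 'cV[R]_m, c * (\sum_i x i 0 ^+ 2) <= (x^T *m A *m x) 0 0.
Proof.
move=> [A_sym A_pos].
have A_ge0 (x : 'cV[R]_m) : 0 <= (x^T *m A *m x) 0 0.
  have [->|x0] := eqVneq x 0; last by rewrite ltW ?A_pos.
  by rewrite mulmx0 mxE.
have A_unit : A \in unitmx.
  rewrite -row_free_unit; apply: inj_row_free => v vA; apply/eqP; apply: contraT => v0.
  have vT0 : v^T != 0 by apply: contra v0 => /eqP vT; rewrite -[v]trmxK vT trmx0.
  by have := A_pos _ vT0; rewrite trmxK vA mul0mx mxE ltxx.
pose B := invmx A; pose S := \sum_i \sum_j `|B i j|.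
have S0 : 0 <= S by do 2![apply: sumr_ge0 => ? _].
pose M := 1 + S; have M1 : 1 <= M by rewrite lerDl.
have M0 : 0 < M by apply: lt_le_trans M1.
exists M^-1 => [|x]; first by rewrite invr_gt0 M0 invf_le1.
set N := \sum_i _; pose y := B *m x.
have x2 i : x i 0 ^+ 2 <= N.
  by rewrite /N (bigD1 i) //= lerDl sumr_ge0 // => j _; rewrite sqr_ge0.
have N0 : 0 <= N by apply: sumr_ge0 => i _; rewrite sqr_ge0.
have Ay : A *m y = x by rewrite mulmxA mulmxV // mul1mx.
have yA : y^T *m A = x^T by rewrite -{1}A_sym -trmx_mul Ay.
have xx : (x^T *m x) 0 0 = N.
  by rewrite mxE; apply: eq_bigr => i _; rewrite mxE expr2.
have yy : (x^T *m y) 0 0 <= M * N.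
  rewrite mulmxA quadratic_form_sum mulrDl mul1r ler_wpDl //.
  rewrite mulr_suml; apply: ler_sum => i _; rewrite mulr_suml; apply: ler_sum => j _.
  rewrite mulrAC mulrC (le_trans (ler_norm _)) // normrM ler_wpM2l // normrM.
  have := x2 i; have := x2 j; rewrite -!(real_normK (num_real (x _ _))).
  have := sqr_ge0 (`|x i 0| - `|x j 0|); rewrite sqrrB; lra.
have trE : (x - M^-1 *: y)^T = x^T - M^-1 *: y^T by rewrite linearB /= linearZ.
have := A_ge0 (x - M^-1 *: y); rewrite trE mulmxBl -scalemxAl yA mulmxBl !mulmxBr.
rewrite -!scalemxAl -!scalemxAr -(mulmxA x^T A y) Ay.
have entry (P Q W Z : 'M[R]_1) : (P - Q - (W - Z)) 0 0 = P 0 0 - Q 0 0 - (W 0 0 - Z 0 0).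
  by rewrite !mxE.
have scale (a : R) (P : 'M[R]_1) : (a *: P) 0 0 = a * P 0 0 by rewrite mxE.
rewrite entry !scale xx => h.
have Mi : 0 < M^-1 by rewrite invr_gt0.
have := ler_wpM2l (ltW Mi) (ler_wpM2l (ltW Mi) yy).
rewrite (mulrA M^-1 M N) mulVf ?gt_eqF // mul1r; lra.
Qed.

Section LinkEigenvalues.
Variables (R : realType) (V : choiceType) (X : set {fset V}) (n : nat).
Variable part : V -> 'I_n.+1.
Hypotheses (X_pure : pure_dimensional X n) (X_partite : partite X part)
  (X_links : connected_finite_1links X n).

Local Notation C := (chamber X n).
Local Notation lambda := (type_eigenvalue R X part).

Section Pair.
Variables i j : 'I_n.+1.
Hypothesis ij : i != j.

Let types := [set link_eigenvalue R X s | s in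
  [set s | simplices X (n%:Z - 2) s /\ type_of part s = ~: [set i; j]]].

Let types_face x : types x -> exists s : C, x = link_eigenvalue R X (face part [set i; j] (val s)).
Proof.
move=> [eta [[Xeta _] etaT] <-].
have [t tc te] := type_of_face_of_chamber X_pure X_partite Xeta etaT.
by exists (mk_chamber tc); rewrite /= te.
Qed.

Let face_types (s : C) : types (link_eigenvalue R X (face part [set i; j] (val s))).
Proof.
exists (face part [set i; j] (val s)) => //; split.
  exact: (face_simplex2 X_pure X_partite ij (chamberP s)).
exact: (type_of_face X_partite _ (chamberP s)).
Qed.

Let link_le1 (s : C) : link_eigenvalue R X (face part [set i; j] (val s)) <= 1.
Proof.
have [v0 _] := link_inhabited X_pure X_partite X_links s ij.
apply: (@second_eigenvalue_le1 R _ _ (fun u => part (val u) == i) v0).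
- exact: link_sym.
- exact: link_degree_gt0.
- exact: link_bipartite.
Qed.

Lemma link_eigenvalue_le_type (s : C) :
  link_eigenvalue R X (face part [set i; j] (val s)) <= lambda i j.
Proof.
apply: ub_le_sup; last exact: face_types.
by exists 1 => x /types_face[t ->].
Qed.

Lemma type_eigenvalue_ge0 (s0 : C) : -1 < lambda i j -> 0 <= lambda i j.
Proof.
move=> gtN1; have [|x /types_face[s ->] gt] := sup_gt _ gtN1.
  by exists (link_eigenvalue R X (face part [set i; j] (val s0))); apply: face_types.
apply: le_trans (link_eigenvalue_le_type s).
have [v0 _] := link_inhabited X_pure X_partite X_links s ij.
apply: (@second_eigenvalue_ge0 R _ _ (fun u => part (val u) == i) v0) => //.
- exact: link_sym.
- exact: link_degree_gt0.
- exact: link_bipartite.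
Qed.

End Pair.

Lemma A_matrix_form (q : 'I_n.+1 -> R) (x := \col_i q i) :
  (x^T *m A_matrix R X part *m x) 0 0 =
  \sum_i (q i ^+ 2 - \sum_(j | j != i) lambda i j * (q i * q j)).
Proof.
rewrite quadratic_form_sum; apply: eq_bigr => i _; rewrite (bigD1 i) //=.
rewrite !mxE eqxx mulr1 -expr2 -sumrN; congr (_ + _); apply: eq_bigr => j ji.
by rewrite !mxE eq_sym (negPf ji); ring.
Qed.

Hypothesis A_posdef : positive_definite (A_matrix R X part).

(** On the difference of two basis vectors the form is twice one plus the
    eigenvalue of the pair. *)
Lemma type_eigenvalue_gtN1 i j : i != j -> -1 < lambda i j.
Proof.
move=> ij; have [A_sym A_pos] := A_posdef.
pose q k : R := (k == i)%:R - (k == j)%:R.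
have q0 : \col_k q k != 0.
  apply/eqP => /matrixP /(_ i 0) /eqP.
  by rewrite !mxE /q eqxx (negPf ij) subr0 oner_eq0.
have := A_pos _ q0; rewrite quadratic_form_sum.
have pick (F : 'I_n.+1 -> R) : \sum_k q k * F k = F i - F j.
  rewrite /q; under eq_bigr => k _ do rewrite mulrBl.
  rewrite big_split sumrN /=; congr (_ - _).
    by rewrite (bigD1 i) //= eqxx mul1r big1 ?addr0 // => k /negPf ->; rewrite mul0r.
  by rewrite (bigD1 j) //= eqxx mul1r big1 ?addr0 // => k /negPf ->; rewrite mul0r.
have -> : \sum_k \sum_l (\col_k q k) k 0 * A_matrix R X part k l * (\col_k q k) l 0 =
    \sum_k q k * \sum_l q l * A_matrix R X part k l.
  apply: eq_bigr => k _; rewrite mulr_sumr; apply: eq_bigr => l _; rewrite !mxE; ring.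
rewrite pick !pick.
have := congr1 (fun M : 'M[R]_n.+1 => M i j) A_sym.
rewrite [in X in X -> _]mxE => ->.
by rewrite !mxE !eqxx (negPf ij); lra.
Qed.

Lemma type_eigenvalue_gap : exists2 c : R, 0 < c <= 1 &
  forall q : 'I_n.+1 -> R, c * (\sum_i q i ^+ 2) <=
    \sum_i (q i ^+ 2 - \sum_(j | j != i) lambda i j * (q i * q j)).
Proof.
have [c c01 cP] := positive_definite_gap A_posdef; exists c => // q.
rewrite -A_matrix_form; apply: le_trans (cP _).
by under [in leRHS]eq_bigr => i _ do rewrite mxE.
Qed.

End LinkEigenvalues.

(** * Property (T) *)

Theorem theorem3p6 (R : realType) (n : nat) (V : choiceType)
    (X : set {fset V}) (part : V -> 'I_n.+1)
    (G : topologicalGroupType) (act : G -> V -> V)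
    (X_pure : pure_dimensional X n)
    (X_partite : partite X part)
    (X_gallery : gallery_connected X n)
    (X_links : connected_finite_1links X n)
    (G_lc : locally_compact_group G)
    (G_unimodular : unimodular R G)
    (G_acts : simplicial_action X act)
    (G_cocompact : cocompact X act)
    (G_stab : forall s : {fset V},
       simplices X (n%:Z - 2) s \/ simplices X (n%:Z - 1) s \/
         simplices X n%:Z s ->
       open (stabilizer act s) /\ compact (stabilizer act s))
    (A_posdef : positive_definite (A_matrix R X part)) :
  property_T R G.
Proof.
have [s1 _] := chamber_inhabited X_pure.
have stab s : simplices X (n%:Z - 1) s \/ simplices X n%:Z s ->
    open (stabilizer act s) /\ compact (stabilizer act s).
  by move=> ?; apply: G_stab; right.
have [n0|n_gt0] := posnP n.
  (* In dimension zero the empty simplex is a facet, stabilized by all of [G]. *)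
  apply: compact_property_T; have [|_] := stab fset0.
    left; split; first exact: (subsimplex X_pure (chamberP s1).1 (fsub0set _)).
    by rewrite cardfs0; lia.
  rewrite (_ : stabilizer act fset0 = setT) //; apply/seteqP; split=> // g _.
  by rewrite /stabilizer /= /act_simplex imfset0.
have [_ G_hausdorff] := G_lc; have [mu [mu_haar mu_right]] := G_unimodular.
pose G0 := type_preserving X part act; pose gact : G -> chamber X n -> chamber X n := chamber_act G_acts.
have st_open s := transporter_open_stab X_pure X_partite X_gallery G_acts stab s.
have st_compact s : compact (transporter G0 gact s s).
  exact: (transporter_compact_stab X_pure X_partite X_gallery G_hausdorff stab).
have G01 : G0 1%g by apply: type_preserving1.
have G0M : forall g h, G0 g -> G0 h -> G0 (g * h)%g.
  by move=> g h; apply: type_preservingM.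
have G0V : forall g, G0 g -> G0 g^-1%g by move=> g; apply: type_preservingV.
have act1 : forall s, gact 1%g s = s by move=> s; apply: chamber_act1.
have actM : forall g h s, gact (g * h)%g s = gact g (gact h s).
  by move=> g h s; apply: chamber_actM.
have act_inj g : G0 g -> injective (gact g).
  by move=> _ s t /(congr1 (gact g^-1%g)); rewrite -!actM mulVg !act1.
have [reps [reps_uniq reps_inj reps_cover]] :=
  finite_orbit_representatives X_pure X_partite X_gallery G_acts G_cocompact.
have {}reps_inj : forall s t, s \in reps -> t \in reps -> same_orbit G0 gact s t -> s = t.
  exact: reps_inj.
have [D DP] := finite_index X_pure X_partite X_gallery G_acts.
pose cls k : chamber X n -> {fset chamber X n} := class part [set k].
pose cls2 i j : chamber X n -> {fset chamber X n} := class part [set i; j].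
have cls_in i s t : (t \in cls i s) = (face part [set i] (val t) == face part [set i] (val s)).
  exact: in_class1.
have cls2_in i j s t : i != j ->
    (t \in cls2 i j s) = (face part [set i; j] (val t) == face part [set i; j] (val s)).
  exact: in_class2.
have cls_act i g s : G0 g -> cls i (gact g s) = (gact g @` cls i s)%fset.
  by move=> Gg; apply: class_act => // t; apply: finite_class1.
have cls2_act i j g s : i != j -> G0 g -> cls2 i j (gact g s) = (gact g @` cls2 i j s)%fset.
  by move=> ij Gg; apply: class_act => // t; apply: finite_class2.
have cls_refl i s : s \in cls i s by rewrite cls_in.
have cls_eq i s t : t \in cls i s -> cls i t = cls i s.
  by rewrite cls_in => /eqP ts; apply/fsetP => u; rewrite !cls_in ts.
have cls2_eq i j s t : i != j -> t \in cls2 i j s -> cls2 i j t = cls2 i j s.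
  by move=> ij; rewrite cls2_in // => /eqP ts; apply/fsetP => u; rewrite !cls2_in // ts.
pose w := weight mu G0 gact.
have w_gt0 s : 0 < w s by apply: weight_gt0.
have averaged cl := @weight_locally_averaged R G mu G_hausdorff mu_haar mu_right
  (chamber X n) G0 gact G01 G0M G0V act1 actM st_open st_compact cl.
have cls_averaged i : locally_averaged G0 gact reps w (cls i).
  exact: (averaged _ (cls_refl i) (cls_eq i) (cls_act i) reps reps_uniq reps_inj reps_cover).
have cls2_averaged i j : i != j -> locally_averaged G0 gact reps w (cls2 i j).
  move=> ij; apply: (averaged _ _ _ _ reps reps_uniq reps_inj reps_cover).
  - by move=> s; rewrite cls2_in.
  - by move=> s t; apply: cls2_eq.
  - by move=> g s; apply: cls2_act.
pose kappa := type_eigenvalue R X part.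
have kappa_ge0 i j : i != j -> 0 <= kappa i j.
  by move=> ij; apply: type_eigenvalue_ge0 => //; apply: type_eigenvalue_gtN1.
have [c c01 gap] := type_eigenvalue_gap A_posdef.
have /choice[gr grP] : forall t, exists gr : G * chamber X n,
    [/\ G0 gr.1, gr.2 \in reps & t = gact gr.1 gr.2].
  by move=> t; have [g [s ?]] := reps_cover t; exists (g, s).
pose gg t := (gr t).1; pose rr t := (gr t).2.
have rr_act g t : G0 g -> rr (gact g t) = rr t.
  move=> Gg; have [G1 r1 e1] := grP t; have [G2 r2 e2] := grP (gact g t).
  apply: reps_inj => //; apply/asboolP; exists ((gg t)^-1 * g^-1 * gg (gact g t))%g.
  split; first by apply: (G0M _ _ _ G2); apply: G0M; apply: G0V.
  rewrite !actM -e2 -[gact g^-1%g _]actM mulVg act1.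
  by apply: (act_inj _ G1); rewrite -actM mulgV act1.
have connected (P : chamber X n -> Prop) s : P s ->
    (forall s t i, P s -> t \in cls i s -> P t) -> forall t, P t.
  move=> Ps step; apply: (chamber_ind X_partite X_gallery Ps) => u t i Pu ut.
  by apply: (step u t i) => //; rewrite cls_in; apply/eqP.
have [g1 [s0 [_ s0r _]]] := reps_cover s1.
pose M := displacement n reps w c s0.
pose nbrs := [seq gg t | t <- flatten [seq enum_fset (cls i s) | s <- reps, i <- enum 'I_n.+1]].
(* The stabilizers control the initial function at the representatives, [nbrs] at
   their neighbours, and [D] the passage from the type-preserving subgroup to [G]. *)
pose K := \bigcup_(s in [set` reps]) transporter G0 gact s s `|` [set` nbrs ++ D].
have M0 : 0 <= M.
  have [_ r1] := andP (rate01 n c01).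
  by rewrite /M /displacement addr_ge0 // !mulr_ge0 ?invr_ge0 ?sqrtr_ge0 ?subr_ge0 ?(ltW r1).
(* Chosen so that [eps * (2 * M + 1)] is one half. *)
pose eps := (2 * (2 * M + 1))^-1.
have eps0 : 0 < eps by rewrite invr_gt0; lra.
apply: (@property_T_of_uniform R G K eps) => //.
- apply: compactU; first by rewrite bigcup_seq; apply: bigsetU_compact => s _; apply: st_compact.
  by apply: finite_compact; apply: finite_seq.
- by exists 1%g; left; exists s0.
move=> H ip rep ipn repU x _ Kx.
have Kstab s g : s \in reps -> G0 g -> gact g s = s -> rnorm (rep g x - x) <= eps.
  by move=> sr Gg gs; apply: Kx; left; exists s.
have Knbr s i t : s \in reps -> t \in cls i s -> rnorm (rep (gg t) x - x) <= eps.
  move=> sr ts; apply: Kx; right; rewrite /= mem_cat; apply/orP; left; apply: map_f.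
  by apply/flattenP; exists (enum_fset (cls i s)) => //; apply/allpairsP; exists (s, i); rewrite mem_enum.
have KD d : d \in D -> rnorm (rep d x - x) <= eps.
  by move=> dD; apply: Kx; right; rewrite /= mem_cat dD orbT.
have angle i j : i != j -> forall phi s (t : R), 0 < t -> _ :=
  fun ij phi s t => class2_angle X_pure X_partite X_links ij ip phi
    (link_eigenvalue_le_type R X_pure X_partite X_links ij s) (kappa_ge0 i j ij).
have [y [y_inv yx]] := near_type_preserving_invariant ipn repU act_inj cls_refl cls_eq cls_act
  (fun s _ => w_gt0 s) reps_cover cls_averaged cls2_averaged kappa_ge0 angle c01 gap
  G01 G0M G0V act1 actM grP rr_act connected (ltW eps0) s0r Kstab Knbr.
move=> g; have [d dD dg] := DP g.
have -> : g = (d * (d^-1 * g))%g by rewrite mulVKg.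
rewrite (repM repU) (le_trans (rnorm_dist3 _ (rep d x) _)) //.
rewrite -(rep_sub repU) (rnorm_rep ipn repU).
have g0x : rnorm (rep (d^-1 * g)%g x - x) <= 2 * (eps * M).
  rewrite (le_trans (rnorm_dist3 _ y _)) // -{1}(y_inv _ dg) -(rep_sub repU).
  by rewrite (rnorm_rep ipn repU) rnormB mulr2n mulrDl mul1r lerD.
apply: le_trans (lerD g0x (KD d dD)) _.
rewrite (_ : 2 * (eps * M) + eps = eps * (2 * M + 1)); last ring.
by rewrite /eps ler_pdivrMl; lra.
Qed.
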